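(* Let $\boldsymbol\mu:[0,T]\to\mathcal P_\pi(\Omega\times\mathbb R^d)$ be a Borel distributional solution of $$\partial_t\boldsymbol\mu(t)+\mathrm{div}_x(\mathbf v(t)\boldsymbol\mu(t))=0,\qquad(\mathrm E)$$ let $\{\mu_\omega(\cdot)\}_{\omega\in\Omega}$ be the $\pi$-almost uniquely determined Borel collection of curves such that $\boldsymbol\mu(t)=\int_\Omega\mu_\omega(t)\,d\pi(\omega)$, and suppose that $$\int_0^T\int_{\Omega\times\mathbb R^d}\frac{|\mathbf v(t,\omega,x)|}{1+|x|}\,d\boldsymbol\mu(t)(\omega,x)\,dt<+\infty.\qquad(\mathrm B)$$ Then for $\pi$-almost every $\omega\in\Omega$, the curve $\mu_\omega:[0,T]\to\mathcal P(\mathbb R^d)$ solves, in the sense of distributions on $(0,T)\times\mathbb R^d$, the continuity equation $$\partial_t\mu_\omega(t)+\mathrm{div}_x(\mathbf v(t,\omega)\mu_\omega(t))=0.\qquad(\mathrm E_\omega)$$ Conversely, if $\{\mu_\omega(\cdot)\}_{\omega\in\Omega}\subset C^0([0,T],\mathcal P(\mathbb R^d))$ is a Borel collection of solutions of $(\mathrm E_\omega)$, then the curve $\boldsymbol\mu:[0,T]\to\mathcal P_\pi(\Omega\times\mathbb R^d)$ defined by $\boldsymbol\mu(t)=\int_\Omega\mu_\omega(t)\,d\pi(\omega)$, assumed to satisfy (B), solves (E).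
   Context: $\Omega$ is a Polish space, $\pi$ a probability measure on $\Omega$, and $(\Omega,\mathcal A,\pi)$ the corresponding complete probability space. $T>0$. $\mathcal P_\pi(\Omega\times\mathbb R^d)$ is the set of Borel probability measures with first marginal $\pi$. Each such measure has a $\pi$-a.e. unique Borel disintegration $\boldsymbol\mu=\int_\Omega\mu_\omega\,d\pi(\omega)$, i.e. $\int\phi\,d\boldsymbol\mu=\int_\Omega\int_{\mathbb R^d}\phi(\omega,x)\,d\mu_\omega(x)\,d\pi(\omega)$ for bounded Borel $\phi$. $\mathcal P(\mathbb R^d)$ carries the narrow topology. The field $\mathbf v:[0,T]\times\Omega\times\mathbb R^d\to\mathbb R^d$ is Lebesgue-Borel: $\mathcal L^1\times\pi$-measurable in $(t,\omega)$ and Borel in $x$ (understood jointly). $\mathrm{Adm}((0,T)\times\Omega\times\mathbb R^d)$ is the set of $\phi\in C^0_b([0,T]\times\Omega\times\mathbb R^d,\mathbb R)$ with $\phi(\cdot,\omega,\cdot)\in C^1_c((0,T)\times\mathbb R^d)$ for all $\omega$ and $\sup_{\omega}\|\phi(\cdot,\omega,\cdot)\|_{C^1}<+\infty$. $\boldsymbol\mu$ is a distributional solution of (E) if $\int_0^T\int_{\Omega\times\mathbb R^d}(\partial_t\phi+\langle\nabla_x\phi,\mathbf v\rangle)\,d\boldsymbol\mu(t)\,dt=0$ for every $\phi\in\mathrm{Adm}((0,T)\times\Omega\times\mathbb R^d)$. Similarly, $\mu_\omega$ solves $(\mathrm E_\omega)$ if $\int_0^T\int_{\mathbb R^d}(\partial_t\varphi(t,x)+\langle\nabla_x\varphi(t,x),\mathbf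 v(t,\omega,x)\rangle)\,d\mu_\omega(t)(x)\,dt=0$ for every $\varphi\in C^1_c((0,T)\times\mathbb R^d,\mathbb R)$.
   Formalization: Solving (E) is required only for those test functions in Adm whose integrand is absolutely integrable, since under (B) alone the integral in (E) can fail to exist when the x-supports of φ(·,ω,·) are not uniformly bounded, which makes the converse as stated ill-defined. *)

(* Defs.v *)
From HB Require Import structures.
From mathcomp Require Import all_boot all_order all_algebra.
From mathcomp Require Import all_classical all_reals all_analysis.
From mathcomp Require Import measurable_realfun.

Set Implicit Arguments.
Unset Strict Implicit.
Unset Printing Implicit Defensive.

Import Order.TTheory GRing.Theory Num.Theory.
Import numFieldNormedType.Exports.

Local Open Scope classical_set_scope.
Local Open Scope ring_scope.

Notation borel T := (g_sigma_algebraType (@open T)).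

(* The library lacks the join of the pointed and topological structures on
   products. *)
HB.instance Definition _ (X Y : ptopologicalType) := Pointed.on (X * Y)%type.

Section Polish.
Context (R : realType) (X : topologicalType).

(* [dist] is a complete metric inducing the topology of [X]. *)
Definition complete_metric_for (dist : X -> X -> R) : Prop :=
  [/\ forall x y, dist x y = 0 <-> x = y,
      forall x y, dist x y = dist y x,
      forall x y z, dist x z <= dist x y + dist y z,
      forall x A, nbhs x A <->
        exists2 e : R, 0 < e & [set y | dist x y < e] `<=` A &
      forall u : nat -> X,
        (forall e : R, 0 < e -> exists N, forall n m,
          (N <= n)%N -> (N <= m)%N -> dist (u n) (u m) < e) ->
        exists l : X, u @ \oo --> l].

Definition polish_space : Prop :=
  (exists2 A : set X, countable A & dense A) /\
  (exists dist, complete_metric_for dist).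

End Polish.

Section Narrow.
Context (R : realType) (X : ptopologicalType).

Definition bounded_continuous : Type :=
  {f : X -> R | continuous f /\ bounded_fun f}.

Definition narrow_eval (m : probability (borel X) R) :
    {ptws bounded_continuous -> R} :=
  fun f => (\int[m]_x sval f x)%R.

(* The Borel probability measures on [X] with the narrow topology, i.e. the
   coarsest one making m |-> \int f dm continuous for every f in C_b(X). *)
Definition narrow_space : Type := initial_topology narrow_eval.

End Narrow.
Arguments narrow_space R X : clear implicits.

Section Calculus.
Context (R : realType) (d : nat).
Local Notation E := 'rV[R]_d.

Definition dotv (u w : E) : R := \sum_i u 0 i * w 0 i.

(* The norm of the library on row vectors is the sup norm. *)
Definition enorm (u : E) : R := Num.sqrt (dotv u u).

Definition dtime (g : R -> E -> R) (t : R) (x : E) : R := 'D_1 (g ^~ x) t.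

Definition grad (g : R -> E -> R) (t : R) (x : E) : E :=
  \row_i 'D_(delta_mx 0 i) (g t) x.

Definition is_C1 (g : R -> E -> R) : Prop :=
  [/\ forall t x, derivable (g ^~ x) t 1,
      forall t x i, derivable (g t) x (delta_mx 0 i),
      continuous (fun q : R * E => dtime g q.1 q.2) &
      continuous (fun q : R * E => grad g q.1 q.2)].

(* C^1_c((0,T) x R^d); its elements are extended by 0 to R x R^d. *)
Definition C1c (T : R) (g : R -> E -> R) : Prop :=
  let supp := closure [set q : R * E | g q.1 q.2 != 0] in
  [/\ is_C1 g, compact supp & supp `<=` [set q | 0 < q.1 < T]].

Definition C1_norm (g : R -> E -> R) : \bar R :=
  ereal_sup [set (`|g q.1 q.2| + `|dtime g q.1 q.2|
                  + enorm (grad g q.1 q.2))%:E | q in [set: R * E]].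

End Calculus.

Section ContinuityEquation.
Context (R : realType) (Omega : ptopologicalType)
  (mpi : probability (borel Omega) R) (T : R) (d : nat).
Local Notation E := 'rV[R]_d.

(* Time-dependent objects are total functions of time, only their values on
   [0, T] matter. *)
Implicit Types (v : R -> Omega -> E -> E)
  (mu : R -> probability (borel (Omega * E)%type) R)
  (kappa : Omega -> R -> probability (borel E) R).

Definition first_marginal (m : probability (borel (Omega * E)%type) R) : Prop :=
  forall A : set (borel Omega), measurable A -> m (A `*` setT) = mpi A.

Definition disintegration (m : probability (borel (Omega * E)%type) R)
    (k : Omega -> probability (borel E) R) : Prop :=
  forall f : borel (Omega * E)%type -> R,
    measurable_fun setT f -> bounded_fun f ->
    (\int[m]_p (f p)%:E = \int[mpi]_w \int[k w]_x (f (w, x))%:E)%E.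

Definition borel_curve mu : Prop :=
  measurable_fun `[0, T]
    (mu : R -> borel (narrow_space R (Omega * E)%type)).

Definition borel_collection kappa : Prop :=
  measurable_fun [set p : R * borel Omega | p.1 \in `[0, T]]
    ((fun p => kappa p.2 p.1) : _ -> borel (narrow_space R E)).

Definition continuous_curve (c : R -> probability (borel E) R) : Prop :=
  {within `[0, T], continuous (c : R -> narrow_space R E)}.

(* R x Omega with the completion of the Borel sigma-algebra for the product of
   the Lebesgue measure with [mpi]. *)
Definition completed_time_space : Type :=
  g_sigma_algebraType
    (completed_algebra_gen (@lebesgue_measure R \x mpi)%E).

Definition lebesgue_borel v : Prop :=
  measurable_fun
    [set p : completed_time_space * borel E | p.1.1 \in `[0, T]]
    ((fun p => v p.1.1 p.1.2 p.2) : _ -> borel E).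

Definition Adm (phi : R -> Omega -> E -> R) : Prop :=
  let D := [set p : R * Omega * E | p.1.1 \in `[0, T]] in
  [/\ {within D, continuous (fun p => phi p.1.1 p.1.2 p.2)},
      [bounded phi p.1.1 p.1.2 p.2 | p in D],
      forall w, C1c T (fun t => phi t w) &
      (ereal_sup [set C1_norm (fun t => phi t w) | w in [set: Omega]]
         < +oo)%E].

Definition transport (g : R -> E -> R) (b : R -> E -> E) (t : R) (x : E) : R :=
  dtime g t x + dotv (grad g t x) (b t x).

(* The elements of [Adm] need not be supported in a common bounded set of R^d,
   so that the integrand may fail to be integrable even when [growth_bound]
   holds; the equation is required whenever its left-hand side is a convergent
   integral.  Here and below, [v] is only measurable up to null sets; for such
   functions the integral of the library, a difference of suprema over simple
   functions, coincides with the integral for the completed measure. *)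
Definition solves_E v mu : Prop :=
  forall phi, Adm phi ->
    let F t w x := transport (fun s => phi s w) (fun s => v s w) t x in
    (\int[lebesgue_measure]_(t in `[0%R, T])
       \int[mu t]_p (`|F t p.1 p.2|)%:E < +oo)%E ->
    (\int[lebesgue_measure]_(t in `[0%R, T])
       \int[mu t]_p (F t p.1 p.2)%:E = 0)%E.

Definition solves_Eomega (b : R -> E -> E)
    (c : R -> probability (borel E) R) : Prop :=
  forall g, C1c T g ->
    (\int[lebesgue_measure]_(t in `[0%R, T])
       \int[c t]_x (transport g b t x)%:E = 0)%E.

Definition growth_bound v mu : Prop :=
  (\int[lebesgue_measure]_(t in `[0%R, T])
     \int[mu t]_p (enorm (v t p.1 p.2) / (1 + enorm p.2))%:E < +oo)%E.

End ContinuityEquation.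

(* Main.v *)
Require Import Defs.
From HB Require Import structures.
From mathcomp Require Import all_boot all_order all_algebra.
From mathcomp Require Import all_classical all_reals all_analysis.
From mathcomp Require finmap.
From mathcomp Require Import measurable_realfun ring.

Set Implicit Arguments.
Unset Strict Implicit.
Unset Printing Implicit Defensive.

Import Order.TTheory GRing.Theory Num.Theory.
Import numFieldNormedType.Exports.

Local Open Scope classical_set_scope.
Local Open Scope ring_scope.

(* Up to a null set of pairs (t, w), which changes none of the integrals, the
   field is Borel, and Fubini together with the disintegration turns the
   left-hand side of (E) for phi into the integral over w of the left-hand side
   S_phi(w) of (E_w) for phi(., w, .).  This gives the converse at once.

   For the direct part take phi = a(w) g(t, x) with a in C_b(Omega) and g in
   C^1_c, so that the integral of a S_g vanishes for every a; as indicators of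
   open sets are limits of such a, S_g = 0 almost everywhere, for each fixed g.
   The null set can be chosen independently of g because C^1_c contains a
   countable family that approximates every g uniformly, together with its
   derivatives and with supports in a common ball, and because for almost every
   w the growth bound makes S_g(w) continuous for this convergence. *)

(** * Integration up to null sets *)

(** Only the derivatives of a test function enter (E_w), so two test functions are compared through
    their jets. If a jet is bounded by e and vanishes for |x| > n, then on that ball |v| is at most
    a constant times |v|/(1+|x|), and the integrand of (E_w) is at most e c_n (1 + |v|/(1+|x|)). The
    constant c_n grows with n, which is why the approximants must share a ball with their limit; the
    weight 1 + |v|/(1+|x|) is the one function that dominates every integrand.

    Integrability for Fubini has two sources: in the converse it is the convergence condition built
    into [solves_E], in the direct part it is proved for a(w) g(t, x) from this domination.

    Fubini works with products of Borel sigma-algebras, whereas test functions are continuous on a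
    product space. Second countability of [Omega] makes such functions measurable for the product
    sigma-algebra, and the metric provides the continuous approximations of indicators. *)

Section LowerIntegral.
Local Open Scope ereal_scope.
Context d (T : measurableType d) (R : realType).
Variable mu : {measure set T -> \bar R}.
Import HBNNSimple.

(** A simple function below [f], set to 0 on [N], lies below [g] and keeps its integral. *)
Lemma ge0_le_integral_off (N : set T) (f g : T -> \bar R) :
  measurable N -> mu N = 0 -> (forall x, 0 <= f x) -> (forall x, 0 <= g x) ->
  (forall x, ~ N x -> f x <= g x) -> \int[mu]_x f x <= \int[mu]_x g x.
Proof.
move=> mN N0 f0 g0 fg.
rewrite ge0_integralTE// [leRHS]ge0_integralTE//.
apply: ge_ereal_sup => _ [h /= hf <-].
pose h' : {nnsfun T >-> R} := mul_nnsfun h (indic_nnsfun R (measurableC mN)).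
have h'E x : h' x = (h x * \1_(~` N) x)%R by [].
apply: ereal_sup_ubound; exists h'.
  move=> x; rewrite h'E indicE; have [xN|xN] := boolP (x \in N).
    by rewrite in_setC xN mulr0.
  by rewrite in_setC xN mulr1 (le_trans (hf x))// fg// -notin_setE.
rewrite -!integralT_nnsfun; apply: ge0_ae_eq_integral => //.
- exact/measurable_EFinP.
- exact/measurable_EFinP.
- by move=> x _; rewrite lee_fin; exact: fun_ge0.
- by move=> x _; rewrite lee_fin; exact: fun_ge0.
- exists N; split => // x hx; apply: contrapT => Nx; apply: hx => _.
  by rewrite h'E indicE mem_set// mulr1.
Qed.

(* The integral of a nonnegative function is a supremum over the simple
   functions below it, so no measurability of [f] or [g] is involved. *)
Lemma integral_eq_off (D N : set T) (f g : T -> \bar R) :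
  measurable N -> mu N = 0 -> (forall x, D x -> ~ N x -> f x = g x) ->
  \int[mu]_(x in D) f x = \int[mu]_(x in D) g x.
Proof.
move=> mN N0 fg.
have fgD x : ~ N x -> (f \_ D) x = (g \_ D) x.
  by move=> Nx; rewrite !patchE; case: ifPn => // /set_mem /fg ->.
rewrite integral_mkcond [RHS]integral_mkcond integralE [RHS]integralE.
by congr (_ - _); apply/eqP; rewrite eq_le; apply/andP; split;
  apply: (@ge0_le_integral_off N) => // x Nx; rewrite ?funeposE ?funenegE fgD.
Qed.

End LowerIntegral.

(** * Completed measurability as measurability off a null set *)

Section Completion.
Context d1 d2 (Z : measurableType d1) (W : measurableType d2) (R : realType).
Variables (m : {measure set W -> \bar R}) (p : Z -> W).
Hypothesis mp : measurable_fun setT p.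

(** The null set lives in [W] and is removed from [Z] as a cylinder: for a field on pairs (t, w) and
    points x, the exceptional set must not depend on x. *)
Definition measurable_off (S : set Z) : Prop :=
  exists N : set W, [/\ measurable N, m N = 0%E & measurable (S `\` p @^-1` N)].

Let mpre (N : set W) : measurable N -> measurable (p @^-1` N).
Proof. by move=> mN; rewrite -[X in measurable X]setTI; exact: mp. Qed.

Lemma measurable_offW S : measurable S -> measurable_off S.
Proof.
by move=> mS; exists set0; rewrite preimage_set0 setD0; split => //; exact: measure0.
Qed.

Lemma null_bigcup (I : countType) (N : I -> set W) :
  (forall i, measurable (N i)) -> (forall i, m (N i) = 0%E) ->
  measurable (\bigcup_i N i) /\ m (\bigcup_i N i) = 0%E.
Proof.
move=> mN N0; pose N' n := if unpickle n is Some i then N i else set0.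
have mN' n : measurable (N' n) by rewrite /N'; case: unpickle.
rewrite (_ : \bigcup_i N i = \bigcup_n N' n); last first.
  apply/seteqP; split => x [].
    by move=> i _ Nx; exists (pickle i) => //; rewrite /N' pickleK.
  by rewrite /N' => n _; case: unpickle => // i Nx; exists i.
have mU : measurable (\bigcup_n N' n) by exact: bigcupT_measurable.
split=> //; apply/negligibleP => //.
apply: negligible_bigcup => n; rewrite /N'; case: unpickle => [i|].
  by exists (N i); split.
exact: negligible_set0.
Qed.

Lemma measurable_off_sigma_algebra : sigma_algebra setT measurable_off.
Proof.
split.
- exact: measurable_offW.
- move=> A [N [mN N0 mAN]]; exists N; split => //.
  rewrite (_ : _ `\` _ = (~` (A `\` p @^-1` N)) `\` p @^-1` N).
    by apply: measurableD; [exact: measurableC|exact: mpre].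
  apply/seteqP; split => z /= [].
    by move=> [_ Az] Nz; split => // -[].
  by move=> h Nz; split => //; split => // Az; apply: h.
- move=> A /choice [N hN].
  have [mU U0] := @null_bigcup nat N (fun i => let: And3 a _ _ := hN i in a)
    (fun i => let: And3 _ a _ := hN i in a).
  exists (\bigcup_i N i); split => //.
  rewrite setD_bigcupl; apply: bigcup_measurable => n _.
  rewrite (_ : _ `\` _ = (A n `\` p @^-1` N n) `\` p @^-1` (\bigcup_i N i)).
    by apply: measurableD; [by have [] := hN n|exact: mpre].
  apply/seteqP; split => z /= [].
    by move=> Az Nz; split => //; split => // Nnz; apply: Nz; exists n.
  by move=> [].
Qed.

End Completion.

Section CompletedMeasurability.
Context dw dy (W : measurableType dw) (Y : measurableType dy) (R : realType).
Variable m : {measure set W -> \bar R}.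
Local Notation completed := (g_sigma_algebraType (completed_algebra_gen m)).

Lemma completed_measurable_off (B : set completed) :
  measurable B -> measurable_off m id (B : set W).
Proof.
have := measurable_off_sigma_algebra m (@measurable_id _ W setT).
move=> /smallest_sub; apply => _ [A mA [N0 [N [mN Nz sN]]] <-].
exists N; split => //; rewrite preimage_id.
rewrite (_ : _ `\` N = A `\` N); first exact: measurableD.
apply/seteqP; split => x /= [].
  by move=> [//|/sN].
by move=> Ax Nx; split => //; left.
Qed.

(** Sets measurable off a null cylinder form a sigma-algebra, so the two generating families
    suffice: a cylinder over a completed set loses a null set of [W], one over [Y] loses nothing. *)
Lemma completed_prod_measurable_off (S : set (completed * Y)%type) :
  measurable S -> measurable_off m fst (S : set (W * Y)).
Proof.
have := measurable_off_sigma_algebra m (@measurable_fst _ _ W Y).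
move=> /smallest_sub; apply => _ [] [B mB <-]; rewrite setTI.
  have [N [mN N0 mBN]] := completed_measurable_off mB.
  exists N; split => //.
  rewrite (_ : _ `\` _ = fst @^-1` (B `\` N)) //.
  by rewrite -[X in measurable X]setTI; exact: measurable_fst.
apply: measurable_offW.
by rewrite -[X in measurable X]setTI; exact: measurable_snd.
Qed.

(** Restricting to rational levels keeps the superlevel sets countable in number, so that in the
    next lemma their exceptional null sets, over all levels and all indices, unite into one null
    set. *)
Lemma measurable_fun_rat d (T : measurableType d) (D : set T) (f : T -> R) :
  (forall q : rat, measurable (D `&` [set x | ratr q < f x])) ->
  measurable_fun D f.
Proof.
move=> h mD; apply: (measurability _ (RGenOInfty.measurableE R)) => //.
move=> _ [_ [r ->] <-].
rewrite (_ : _ `&` _ = \bigcup_(q in [set q : rat | r < ratr q])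
    (D `&` [set x | ratr q < f x])); last first.
  apply/seteqP; split => x /=.
    move=> [Dx]; rewrite in_itv/= andbT => rf.
    have [q] := rat_in_itvoo rf; rewrite in_itv/= => /andP[rq qf].
    by exists q.
  by move=> [q /= rq [Dx qf]]; split => //; rewrite in_itv/= andbT (lt_trans rq).
rewrite bigcup_mkcond; apply: countable_bigcupT_measurable => // q.
by case: ifP.
Qed.

Lemma completed_measurable_fun_off (I : finType) (D : set (W * Y))
    (f : I -> W * Y -> R) :
  measurable D ->
  (forall i, measurable_fun (D : set (completed * Y)%type) (f i)) ->
  exists N : set W, [/\ measurable N, m N = 0%E &
    forall i, measurable_fun (D `\` fst @^-1` N) (f i)].
Proof.
move=> mD mf.
have mDc : measurable (D : set (completed * Y)%type).
  move: D mD {mf}; apply: smallest_sub; first exact: sigma_algebra_measurable.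
  move=> _ [] [B mB <-]; apply: sub_sigma_algebra; [left|right]; exists B => //.
  by apply: sub_sigma_algebra; exists B => //; exists set0; rewrite ?setU0//;
    exact: negligible_set0.
have h (iq : I * rat) : measurable_off m fst (D `&` [set x | ratr iq.2 < f iq.1 x]).
  apply: completed_prod_measurable_off.
  rewrite (_ : [set x | _] = f iq.1 @^-1` `]ratr iq.2, +oo[); last first.
    by apply/seteqP; split => x /=; rewrite in_itv/= andbT.
  exact: mf.
have [N hN] := choice h.
have [mU U0] := @null_bigcup _ W _ m _ N (fun i => let: And3 a _ _ := hN i in a)
    (fun i => let: And3 _ a _ := hN i in a).
exists (\bigcup_i N i); split => // i.
apply: measurable_fun_rat => q.
have [_ _ mq] := hN (i, q).
rewrite (_ : _ `&` _ = (D `&` [set x | ratr q < f i x] `\` fst @^-1` N (i, q))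
    `\` fst @^-1` (\bigcup_i N i)).
  apply: measurableD => //.
  by rewrite -[X in measurable X]setTI; exact: measurable_fst.
apply/seteqP; split => x /=.
  move=> [[Dx Nx] qf]; split => //; split => // Nq.
  by apply: Nx; exists (i, q).
by move=> [[[Dx qf] _] Nx].
Qed.

End CompletedMeasurability.

(** * Disintegration and Fubini *)

Section KernelIntegral.
Local Open Scope ereal_scope.
Context dv dy (V : measurableType dv) (Y : measurableType dy) (R : realType).
Variable k : V -> probability Y R.
Hypothesis mk : forall U, measurable U -> measurable_fun setT (fun z => k z U).

Let kk : V -> {measure set Y -> \bar R} := fun z => k z.
HB.instance Definition _ := isKernel.Build _ _ V Y R kk mk.
Let kk1 z : kk z [set: Y] = 1. Proof. exact: probability_setT. Qed.
HB.instance Definition _ := Kernel_isProbability.Build _ _ V Y R kk kk1.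

Lemma kernel_integral_measurable_ge0 (f : V * Y -> \bar R) :
  measurable_fun setT f -> (forall z, 0 <= f z) ->
  measurable_fun setT (fun z => \int[k z]_y f (z, y)).
Proof. by move=> mf f0; exact: (measurable_fun_integral_finite_kernel f kk). Qed.

Lemma kernel_integral_measurable (f : V * Y -> \bar R) :
  measurable_fun setT f -> measurable_fun setT (fun z => \int[k z]_y f (z, y)).
Proof.
move=> mf; rewrite [X in measurable_fun _ X](_ : _ = (fun z =>
    \int[k z]_y f^\+ (z, y)) \- (fun z => \int[k z]_y f^\- (z, y))).
  by apply: emeasurable_funB; apply: kernel_integral_measurable_ge0 => //;
    [exact: measurable_funepos|exact: measurable_funeneg].
apply/funext => z /=; rewrite integralE; congr (_ - _);
  by apply: eq_integral => y _; rewrite ?funeposE ?funenegE.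
Qed.

End KernelIntegral.

Section DisintegrationFubini.
Local Open Scope ereal_scope.
Context dx dw dy dz (X : measurableType dx) (W : measurableType dw)
  (Y : measurableType dy) (Z : measurableType dz) (R : realType).
Variables (lam : {sigma_finite_measure set X -> \bar R}) (P : probability W R).
Variables (D : set X) (mD : measurable D).
Variable k : X * W -> probability Y R.
Hypothesis mk : forall U, measurable U -> measurable_fun setT (fun z => k z U).
Variables (j : Z -> W * Y) (mj : measurable_fun setT j).
Variable m : X -> probability Z R.
Hypothesis dis : forall t, D t -> forall f : W * Y -> \bar R,
  measurable_fun setT f -> (forall z, 0 <= f z) ->
  \int[m t]_z f (j z) = \int[P]_w \int[k (t, w)]_y f (w, y).

Implicit Types f : (X * W) * Y -> \bar R.

Local Notation K f := (fun z => \int[k z]_y f (z, y)).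
Local Notation at_time f t := (fun p => f ((t, (j p).1), (j p).2)).

Let slice f t : measurable_fun setT f ->
  measurable_fun setT (fun q : W * Y => f ((t, q.1), q.2)).
Proof.
move=> mf; apply: (measurableT_comp mf); apply: measurable_fun_pair => //.
exact: measurable_fun_pair.
Qed.

(** Since each [k (t, w)] has mass 1, the disintegration gives a cylinder over A the [m t]-mass
    P(A). *)
Let null_section (N : set (X * W)) (t : X) : measurable N -> D t ->
  P (xsection N t) = 0 -> m t (j @^-1` (xsection N t `*` setT)) = 0.
Proof.
move=> mN Dt N0; have mNt := measurable_xsection t mN.
have mS : measurable (xsection N t `*` [set: Y]) by exact: measurableX.
have mS' : measurable (j @^-1` (xsection N t `*` setT)).
  by rewrite -[X in measurable X]setTI; exact: mj.
rewrite -[X in m t X]setIT -integral_indic//.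
transitivity (\int[P]_w \int[k (t, w)]_y (\1_(xsection N t `*` setT) (w, y))%:E).
  rewrite -(dis Dt (f := EFin \o \1_(xsection N t `*` [set: Y]))).
  - apply: eq_integral => z _; by rewrite /= !indicE.
  - exact/measurable_EFinP.
  - by move=> z; rewrite /= lee_fin.
transitivity (\int[P]_w (\1_(xsection N t) w)%:E).
  apply: eq_integral => w _; rewrite (eq_integral (cst (\1_(xsection N t) w)%:E)).
    rewrite integral_cst//. 
    by rewrite -[RHS]mule1; congr (_ * _); exact: probability_setT.
  by move=> y _; rewrite /cst !indicE in_setX in_setT andbT.
by rewrite integral_indic// setIT.
Qed.

Let null_times (N : set (X * W)) : measurable N -> (lam \x P) N = 0 ->
  exists N' : set X, [/\ measurable N', lam N' = 0 &
    forall t, ~ N' t -> P (xsection N t) = 0].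
Proof.
move=> mN N0.
have mf := measurable_fun_xsection P mN.
have : ae_eq lam setT (fun t => P (xsection N t)) (cst 0).
  apply/(ae_eq_integral_abs lam measurableT mf).
  by rewrite -[RHS]N0; apply: eq_integral => t _; rewrite gee0_abs.
move=> [N' [mN' N'0 sN']]; exists N'; split => // t Nt.
by apply: contrapT => h; apply/Nt/sN' => /= /(_ I).
Qed.

(** For almost every time the section of [N] is [P]-null, hence the cylinder over it is [m t]-null.
    The inner integrals then agree off a null set of times. [f0] may be non-measurable, which is
    what allows the original field to be replaced. *)
Lemma integral_time_off (N : set (X * W)) f0 f :
  measurable N -> (lam \x P) N = 0 ->
  (forall z y, D z.1 -> ~ N z -> f0 (z, y) = f (z, y)) ->
  \int[lam]_(t in D) \int[m t]_p at_time f0 t p =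
  \int[lam]_(t in D) \int[m t]_p at_time f t p.
Proof.
move=> mN N0 ff; have [N' [mN' N'0 hN']] := null_times mN N0.
apply: (integral_eq_off mN' N'0) => t Dt /hN' Nt.
apply: (integral_eq_off _ (null_section mN Dt Nt)).
  rewrite -[X in measurable X]setTI; apply: mj => //; apply: measurableX => //.
  exact: measurable_xsection.
move=> p _ /= Np; apply: ff => // Ntp; apply: Np; split => //.
by rewrite /xsection/= inE.
Qed.

(** The functions are quantified inside the almost-everywhere statement: the exceptional parameters
    depend on [N] alone, so one null set serves all test functions. *)
Lemma integral_time_off_ae (N : set (X * W)) :
  measurable N -> (lam \x P) N = 0 ->
  {ae P, forall w, forall f0 f,
    (forall z y, D z.1 -> ~ N z -> f0 (z, y) = f (z, y)) ->
    \int[lam]_(t in D) \int[k (t, w)]_y f0 ((t, w), y) =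
    \int[lam]_(t in D) \int[k (t, w)]_y f ((t, w), y)}.
Proof.
move=> mN N0.
have mf := measurable_fun_ysection lam mN.
have : ae_eq P setT (fun w => lam (ysection N w)) (cst 0).
  apply/(ae_eq_integral_abs P measurableT mf).
  (* By uniqueness the product measure may also be computed from the y-sections, that is, by
     integrating over the parameter last. *)
  have := product_measure_unique (m1 := lam) (m2 := P) (m' := (lam \x^ P)).
  move=> /(_ (fun A B mA mB => product_measure2E lam P mA mB)) /(_ _ mN).
  rewrite [X in X = _]N0 => N0'; rewrite [RHS]N0'.
  by apply: eq_integral => t _; rewrite gee0_abs.
apply: filterS => w /(_ I) Nw f0 f ff.
apply: (integral_eq_off (measurable_ysection w mN) Nw) => t Dt Nt.
apply: eq_integral => y _; apply: ff => // Nz; apply: Nt.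
by rewrite /ysection/= inE.
Qed.

(** Extension by 0 outside [D] trades the time integral over [D] for one over all of [X], the form
    to which Tonelli and Fubini apply. *)
Let patchD f := fun z : X * W => ((fun t => \int[k (t, z.2)]_y f ((t, z.2), y)) \_ D) z.1.

Let measurable_patchD f : measurable_fun setT f -> measurable_fun setT (patchD f).
Proof.
move=> mf.
have mD1 : measurable (fst @^-1` D : set (X * W)).
  by rewrite -[X in measurable X]setTI; exact: measurable_fst.
rewrite [X in measurable_fun _ X](_ : _ = (K f \_ (fst @^-1` D))).
  apply/(measurable_restrict _ mD1 measurableT).
  by apply: measurable_funTS; exact: kernel_integral_measurable.
apply/funext => -[t w]; rewrite /patchD !patchE/=.
by rewrite (_ : ((t, w) \in fst @^-1` D) = (t \in D))// !in_setE; apply/idP/idP; rewrite !inE.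
Qed.

Lemma ge0_disintegration_fubini f :
  measurable_fun setT f -> (forall z, 0 <= f z) ->
  \int[lam]_(t in D) \int[m t]_p at_time f t p =
  \int[P]_w \int[lam]_(t in D) \int[k (t, w)]_y f ((t, w), y).
Proof.
move=> mf f0.
transitivity (\int[lam]_t \int[P]_w patchD f (t, w)).
  rewrite integral_mkcond; apply: eq_integral => t _; rewrite patchE.
  case: ifPn => tD.
    rewrite (dis (set_mem tD) (slice t mf))//.
    by apply: eq_integral => w _; rewrite /patchD patchE tD.
  rewrite integral0_eq// => w _.
  by rewrite /patchD patchE/= (negbTE tD).
rewrite (fubini_tonelli (patchD f)).
- by apply: eq_integral => w _; rewrite [RHS]integral_mkcond.
- exact: measurable_patchD.
- move=> [t w]; rewrite /patchD patchE; case: ifP => // _.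
  exact: integral_ge0.
Qed.

Lemma ge0_measurable_time_kernel f :
  measurable_fun setT f -> (forall z, 0 <= f z) ->
  measurable_fun setT
    (fun w => \int[lam]_(t in D) \int[k (t, w)]_y f ((t, w), y)).
Proof.
move=> mf f0; rewrite [X in measurable_fun _ X](_ : _ =
    fun w => \int[lam]_t patchD f (t, w)).
  apply: (measurable_fun_fubini_tonelli_G (patchD f) (measurable_patchD mf)) => -[t w].
  by rewrite /patchD patchE; case: ifP => // _; exact: integral_ge0.
by apply/funext => w; rewrite integral_mkcond.
Qed.

Let kernel_integral_abs f z : measurable_fun setT f ->
  `|K f z| <= K (abse \o f) z.
Proof.
move=> mf; apply: le_abse_integral => //.
by apply: (measurableT_comp mf); exact: pair1_measurable.
Qed.

Let product_integrable f : measurable_fun setT f ->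
  \int[P]_w \int[lam]_(t in D) \int[k (t, w)]_y `|f ((t, w), y)| < +oo ->
  (lam \x P).-integrable setT (patchD f).
Proof.
move=> mf foo; apply/(integrable21ltyP _ _ (measurable_patchD mf)).
have mfa : measurable_fun setT (abse \o f) by exact: measurableT_comp.
have ge0 z : 0 <= patchD (abse \o f) z.
  rewrite /patchD patchE; case: ifP => // _.
  by apply: integral_ge0 => y _; exact: abse_ge0.
have le z : `|patchD f z| <= patchD (abse \o f) z.
  rewrite /patchD !patchE; case: ifP; rewrite ?abse0// => _.
  exact: (kernel_integral_abs (z.1, z.2) mf).
apply: le_lt_trans foo.
under [leRHS]eq_integral do rewrite integral_mkcond.
have mp := measurable_patchD mf; have mpa := measurable_patchD mfa.
have mp' : measurable_fun setT (abse \o patchD f) by exact: measurableT_comp.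
apply: ge0_le_integral => //.
- by move=> w _; exact: integral_ge0.
- apply: (measurable_fun_fubini_tonelli_G (abse \o patchD f)) => //.
  by move=> z; exact: abse_ge0.
- exact: (measurable_fun_fubini_tonelli_G (patchD (abse \o f)) mpa ge0).
- move=> w _; apply: ge0_le_integral => //.
  + by apply: (measurableT_comp mp'); exact: pair2_measurable.
  + exact: (measurableT_comp mpa (pair2_measurable w)).
Qed.

Lemma integrable_time_kernel f : measurable_fun setT f ->
  \int[P]_w \int[lam]_(t in D) \int[k (t, w)]_y `|f ((t, w), y)| < +oo ->
  P.-integrable setT
    (fun w => \int[lam]_(t in D) \int[k (t, w)]_y f ((t, w), y)).
Proof.
move=> mf foo; have ip := product_integrable mf foo.
have mp := measurable_patchD mf.
have mp' : measurable_fun setT (abse \o patchD f) by exact: measurableT_comp.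
apply: (@eq_integrable _ _ _ _ _ measurableT (fubini_G lam (patchD f))).
  by move=> w _; rewrite /fubini_G [RHS]integral_mkcond.
have mG := measurable_fubini_G ip.
apply/integrableP; split=> //.
apply: le_lt_trans ((integrable21ltyP lam P mp).1 ip).
apply: ge0_le_integral => //.
- exact: measurableT_comp.
- apply: (measurable_fun_fubini_tonelli_G (abse \o patchD f) mp').
  by move=> z; exact: abse_ge0.
- move=> w _; apply: le_abse_integral => //.
  exact: (measurableT_comp mp (pair2_measurable w)).
Qed.

(** The hypothesis [dis] covers nonnegative functions only, so at a fixed time [f] is split into its
    positive and negative parts. For almost every time both have finite integrals, and their
    difference can be recombined on either side. *)
Lemma disintegration_fubini f : measurable_fun setT f ->
  \int[P]_w \int[lam]_(t in D) \int[k (t, w)]_y `|f ((t, w), y)| < +oo ->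
  \int[lam]_(t in D) \int[m t]_p at_time f t p =
  \int[P]_w \int[lam]_(t in D) \int[k (t, w)]_y f ((t, w), y).
Proof.
move=> mf foo.
have mfa : measurable_fun setT (abse \o f) by exact: measurableT_comp.
have ioo := product_integrable mfa.
transitivity (\int[lam]_t \int[P]_w patchD f (t, w)); last first.
  rewrite (Fubini (product_integrable mf foo)).
  by apply: eq_integral => w _; rewrite [RHS]integral_mkcond.
have /ae_integrable1 [N [mN N0 hN]] : (lam \x P).-integrable setT (patchD (abse \o f)).
  apply: ioo; apply: le_lt_trans foo.
  by under eq_integral do under eq_integral do under eq_integral do rewrite /= abse_id.
rewrite integral_mkcond; apply: (integral_eq_off mN N0) => t _ Nt.
have {hN Nt}it : P.-integrable setT (fun w => patchD (abse \o f) (t, w)).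
  by apply: contrapT => h; apply/Nt/hN.
rewrite patchE; case: ifPn => tD; last first.
  rewrite integral0_eq// => w _.
  by rewrite /patchD patchE/= (negbTE tD).
have Dt := set_mem tD.
have mp (g : X * W * Y -> \bar R) : measurable_fun setT g ->
    measurable_fun setT (fun w => K g (t, w)).
  move=> mg; apply: (measurableT_comp (kernel_integral_measurable mk mg)).
  exact: pair1_measurable.
have {}it : P.-integrable setT (fun w => K (abse \o f) (t, w)).
  apply: (eq_integrable measurableT _ _ _ it) => // w _.
  by rewrite /patchD patchE tD.
have dom (g : X * W * Y -> \bar R) : measurable_fun setT g -> (forall z, 0 <= g z) ->
    (forall z, g z <= `|f z|) -> P.-integrable setT (fun w => K g (t, w)).
  move=> mg g0 gf; apply: (le_integrable measurableT _ _ it) => //; first exact: mp.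
  move=> w _; have mc (h : X * W * Y -> \bar R) : measurable_fun setT h ->
      measurable_fun setT (fun y => h (t, w, y)).
    by move=> mh; exact: (measurableT_comp mh (pair1_measurable (t, w))).
  rewrite gee0_abs; last by apply: integral_ge0 => y _.
  rewrite gee0_abs; last by apply: integral_ge0 => y _; exact: abse_ge0.
  by apply: ge0_le_integral => //; [exact: mc|exact: (mc (abse \o f))].
have mfp := measurable_funepos mf; have mfn := measurable_funeneg mf.
transitivity (\int[P]_w (K (f^\+) (t, w) - K (f^\-) (t, w))); last first.
  apply: eq_integral => w _; rewrite /patchD patchE tD [RHS]integralE.
  by congr (_ - _); apply: eq_integral => y _; rewrite ?funeposE ?funenegE.
rewrite integralB//; last 2 first.
- by apply: dom => // z; rewrite -/((abse \o f) z) fune_abse leeDl.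
- by apply: dom => // z; rewrite -/((abse \o f) z) fune_abse leeDr.
rewrite -(dis Dt (slice t mfp))// -(dis Dt (slice t mfn))//.
rewrite integralE.
by congr (_ - _); apply: eq_integral => y _; rewrite ?funeposE ?funenegE.
Qed.

Lemma integral_add1 f : measurable_fun setT f -> (forall z, 0 <= f z) ->
  \int[P]_w \int[lam]_(t in D) \int[k (t, w)]_y (1 + f ((t, w), y)) =
  lam D + \int[P]_w \int[lam]_(t in D) \int[k (t, w)]_y f ((t, w), y).
Proof.
move=> mf f0.
have k1 z : \int[k z]_y (1 + f (z, y)) = 1 + K f z.
  rewrite ge0_integralD//.
    by rewrite integral_cst// mul1e; congr (_ + _); exact: probability_setT.
  exact: (measurableT_comp mf (pair1_measurable z)).
have D1 w : \int[lam]_(t in D) \int[k (t, w)]_y (1 + f ((t, w), y)) =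
    lam D + \int[lam]_(t in D) K f (t, w).
  under eq_integral do rewrite k1.
  rewrite ge0_integralD//.
  - by rewrite integral_cst// mul1e.
  - by move=> t _; exact: integral_ge0.
  - apply: measurable_funTS.
    exact: (measurableT_comp (kernel_integral_measurable mk mf) (pair2_measurable w)).
under eq_integral do rewrite D1.
rewrite ge0_integralD//.
- rewrite integral_cst//; congr (_ + _).
  by rewrite -[RHS]mule1; congr (_ * _); exact: probability_setT.
- by move=> w _; apply: integral_ge0 => t _; exact: integral_ge0.
- exact: ge0_measurable_time_kernel.
Qed.

(** [B] unites the pairs at which [K f] is infinite with the whole cylinder over the parameters
    whose time integral is infinite. Thanks to the cylinder, a single pair outside [B] certifies
    that its parameter is good. *)
Lemma finite_off_null f : measurable_fun setT f -> (forall z, 0 <= f z) ->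
  \int[P]_w \int[lam]_(t in D) \int[k (t, w)]_y f ((t, w), y) < +oo ->
  exists B : set (X * W), [/\ measurable B, (lam \x P) B = 0,
    forall z, D z.1 -> ~ B z -> K f z < +oo &
    forall t w, ~ B (t, w) ->
      \int[lam]_(t in D) \int[k (t, w)]_y f ((t, w), y) < +oo].
Proof.
move=> mf f0 foo.
have foo' : \int[P]_w \int[lam]_(t in D) \int[k (t, w)]_y `|f ((t, w), y)| < +oo.
  apply: le_lt_trans foo; rewrite le_eqVlt; apply/orP; left; apply/eqP.
  by apply: eq_integral => w _; apply: eq_integral => t _; apply: eq_integral => y _;
    rewrite gee0_abs.
have mD1 : measurable (fst @^-1` D : set (X * W)).
  by rewrite -[X in measurable X]setTI; exact: measurable_fst.
pose H w := \int[lam]_(t in D) \int[k (t, w)]_y f ((t, w), y).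
pose B1 := fst @^-1` D `&` (K f @^-1` [set +oo]).
pose B2 := H @^-1` [set +oo].
have mB1 : measurable B1.
  apply: measurableI => //; rewrite -[X in measurable X]setTI.
  exact: (kernel_integral_measurable mk mf).
have iH : P.-integrable setT H by exact: integrable_time_kernel.
have mB2 : measurable B2.
  by rewrite -[X in measurable X]setTI; exact: (measurable_int _ iH).
have B10 : (lam \x P) B1 = 0.
  have [M [mM M0 sM]] := integrable_ae measurableT (product_integrable mf foo').
  apply: (subset_measure0 mB1 mM _ M0) => z [Dz /= fz]; apply: sM => /= /(_ I).
  by rewrite /patchD patchE mem_set//= -surjective_pairing fz.
have B20 : P B2 = 0.
  have [M [mM M0 sM]] := integrable_ae measurableT iH.
  by apply: (subset_measure0 mB2 mM _ M0) => w /= fw; apply: sM => /= /(_ I); rewrite fw.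
have m2 : measurable ([set: X] `*` B2) by exact: measurableX.
exists (B1 `|` setT `*` B2); split.
- exact: measurableU.
- have B30 : (lam \x P) ([set: X] `*` B2) = 0 by rewrite product_measure1E// [X in _ * X]B20 mule0.
  by rewrite measureU0.
- move=> z Dz Bz; rewrite ltey; apply/eqP => fz; apply: Bz; left; split => //.
- move=> t w Bw; rewrite ltey; apply/eqP => fw; apply: Bw; right; split => //.
Qed.

Lemma truncation_finite (B : set (X * W)) (q1 q : X * W * Y -> \bar R) :
  lam D < +oo -> measurable_fun setT q1 -> measurable_fun setT q ->
  (forall z, 0 <= q z) -> (forall z, q z <= q1 z) ->
  (forall z y, D z.1 -> ~ B z -> q (z, y) = q1 (z, y)) ->
  (forall z y, ~ D z.1 \/ B z -> q (z, y) = 1) ->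
  \int[P]_w \int[lam]_(t in D) \int[k (t, w)]_y q1 ((t, w), y) < +oo ->
  (forall z, D z.1 -> ~ B z -> K q1 z < +oo) ->
  (forall t w, ~ B (t, w) ->
    \int[lam]_(t in D) \int[k (t, w)]_y q1 ((t, w), y) < +oo) ->
  [/\ forall z, K q z < +oo,
    forall w, \int[lam]_(t in D) \int[k (t, w)]_y q ((t, w), y) < +oo &
    \int[P]_w \int[lam]_(t in D) \int[k (t, w)]_y q ((t, w), y) < +oo].
Proof.
move=> Doo mq1 mq q0 qq1 qnB qB q1oo kB fB.
have q10 z : 0 <= q1 z by exact: le_trans (qq1 z).
have k1 z : \int[k z]_y (cst 1 y) = 1.
  by rewrite integral_cst// mul1e; exact: probability_setT.
have tq (p : X * W * Y -> \bar R) w : measurable_fun setT p ->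
    measurable_fun D (fun t => K p (t, w)).
  move=> mp; apply: measurable_funTS.
  exact: (measurableT_comp (kernel_integral_measurable mk mp) (pair2_measurable w)).
have yq (p : X * W * Y -> \bar R) z : measurable_fun setT p ->
    measurable_fun setT (fun y => p (z, y)).
  by move=> mp; exact: (measurableT_comp mp (pair1_measurable z)).
have fq_le w : \int[lam]_(t in D) K q (t, w) <= \int[lam]_(t in D) K q1 (t, w).
  apply: ge0_le_integral => //.
  - by move=> t _; apply: integral_ge0.
  - exact: tq.
  - exact: tq.
  - by move=> t _; apply: ge0_le_integral => //; exact: yq.
have Kq1 z : ~ D z.1 \/ B z -> K q z = 1.
  by move=> h; rewrite -(k1 z); apply: eq_integral => y _; exact: qB.
split.
- move=> z; have [h|/not_orP[/contrapT Dz Bz]] := pselect (~ D z.1 \/ B z).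
    by rewrite Kq1// ltry.
  by under eq_integral do rewrite qnB//; exact: kB.
(* Either some pair over [w] avoids [B], and the time integral of [q1] at [w] is finite; or all of
   them lie in [B], where [q] is 1 and the integral is [lam D]. *)
- move=> w; have [[t Btw]|h] := pselect (exists t, ~ B (t, w)).
    exact: (le_lt_trans (fq_le w) (fB t w Btw)).
  rewrite (eq_integral (cst 1)).
    by rewrite integral_cst// mul1e.
  move=> t _; apply: (Kq1 (t, w)); right; apply: contrapT => Btw.
  by apply: h; exists t.
- apply: le_lt_trans q1oo; apply: ge0_le_integral => //.
  + by move=> w _; apply: integral_ge0 => t _; apply: integral_ge0.
  + exact: ge0_measurable_time_kernel.
  + exact: ge0_measurable_time_kernel.
Qed.

End DisintegrationFubini.

(** * Borel sets of metrizable spaces and the narrow topology *)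

Section Metrization.
Context (R : realType) (X : topologicalType).
Variable dist : X -> X -> R.

(** A common interface for the Polish metric of [Omega] and the norm distances of the reals and of
    row vectors. *)
Definition metrizes : Prop :=
  [/\ forall x, dist x x = 0,
      forall x y, dist x y = dist y x,
      forall x y z, dist x z <= dist x y + dist y z &
      forall x A, nbhs x A <->
        exists2 e : R, 0 < e & [set y | dist x y < e] `<=` A].

Hypothesis dm : metrizes.

Let dxx x : dist x x = 0. Proof. by case: dm. Qed.
Let dsym x y : dist x y = dist y x. Proof. by case: dm. Qed.
Let dtri x y z : dist x z <= dist x y + dist y z. Proof. by case: dm. Qed.
Let dnbhs x A : nbhs x A <->
  exists2 e : R, 0 < e & [set y | dist x y < e] `<=` A.
Proof. by case: dm. Qed.
Let dge0 x y : 0 <= dist x y.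
Proof. by rewrite -(@pmulrn_lge0 _ _ 2)// mulr2n {2}dsym -(dxx x). Qed.

Lemma metrizes_ball_open x e : open [set y | dist x y < e].
Proof.
rewrite openE => y /= xy; apply/dnbhs; exists (e - dist x y).
  by rewrite subr_gt0.
move=> z /= yz; rewrite (le_lt_trans (dtri x y z))//.
by rewrite -ltrBrDl.
Qed.

Lemma metrizes_second_countable (A : set X) :
  countable A -> dense A -> @second_countable X.
Proof.
move=> cA dA.
exists [set [set y | dist an.1 y < an.2.+1%:R^-1] | an in A `*` setT].
  by apply: (sub_countable (card_image_le _ _)); exact: countableX.
split=> [_ [an _ <-]|x U /dnbhs[e e0 xU]]; first exact: metrizes_ball_open.
have [n ne] : exists n : nat, n.+1%:R^-1 < e / 2.
  have : (\forall n \near \oo, (n.+1%:R^-1 : R) < e / 2).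
    have e20 : 0 < e / 2 by rewrite divr_gt0.
    exact: (near_infty_natSinv_lt (PosNum e20)).
  by case=> n _ /(_ n) h; exists n; apply: h => /=.
have [|a [xa Aa]] := dA [set y | dist x y < n.+1%:R^-1] _ (metrizes_ball_open _ _).
  by exists x; rewrite /= dxx.
exists [set y | dist a y < n.+1%:R^-1].
  by split; [exists (a, n)|rewrite /= dsym].
move=> y /= ay; apply: xU => /=.
rewrite (le_lt_trans (dtri x a y))// (splitr e) ltrD// (lt_trans _ ne)//.
Qed.

(* The distance to the complement of [U], capped by 1 so that the infimum is
   over a nonempty set even when [U] is the whole space. *)
Let gap (U : set X) (x : X) : R := inf (1 |` [set dist x y | y in ~` U]).

Let gap_lb U x : lbound (1 |` [set dist x y | y in ~` U]) 0.
Proof. by move=> _ [->//|[y _ <-]]; exact: dge0. Qed.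

Let gap_ge0 U x : 0 <= gap U x.
Proof. by apply: lb_le_inf; [exists 1; left|exact: gap_lb]. Qed.

Let gap_le U x s : (1 |` [set dist x y | y in ~` U]) s -> gap U x <= s.
Proof. by move=> h; apply: ge_inf => //; exists 0; exact: gap_lb. Qed.

Let gap_lip U x y : gap U x <= gap U y + dist x y.
Proof.
rewrite -lerBlDr; apply: lb_le_inf; first by exists 1; left.
move=> _ [->|[z Uz <-]]; rewrite lerBlDr.
  by rewrite (@le_trans _ _ 1)//; [apply: gap_le; left|rewrite lerDl].
by rewrite addrC (le_trans _ (dtri x y z))//; apply: gap_le; right; exists z.
Qed.

Let gap_continuous U : continuous (gap U).
Proof.
move=> x; apply/cvgrPdist_lt => e e0; apply/dnbhs; exists e => // y /= xy.
rewrite distrC ltr_distl; apply/andP; split.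
  by rewrite ltrBlDr (le_lt_trans (gap_lip U x y))// ltrD2l.
by rewrite (le_lt_trans (gap_lip U y x))// ltrD2l dsym.
Qed.

(** The gap is positive on [U], where n times it eventually exceeds 1, and it is 0 outside;
    truncating n times the gap at 1 gives the sequence. *)
Lemma open_indic_limit (U : set X) : open U ->
  exists f : nat -> X -> R, [/\ forall n, continuous (f n),
    forall n x, 0 <= f n x <= 1 &
    forall x, f n x @[n --> \oo] --> (\1_U x : R)].
Proof.
move=> oU; exists (fun n x => Num.min (n%:R * gap U x) 1); split.
- move=> n x; apply: (@continuous_min R X (fun x => n%:R * gap U x) (cst 1)); last exact: cvg_cst.
  by apply: cvgM; [exact: cvg_cst|exact: gap_continuous].
- move=> n x; rewrite ge_min lexx orbT andbT le_min ler01 andbT.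
  by rewrite mulr_ge0.
- move=> x; rewrite indicE; have [xU|xU] := boolP (x \in U).
    have [e e0 eU] : exists2 e, 0 < e & e <= gap U x.
      have /dnbhs[e e0 eU] : nbhs x U by apply: open_nbhs_nbhs; split => //; exact: set_mem.
      exists (Num.min 1 e); first by rewrite lt_min ltr01.
      apply: lb_le_inf; first by exists 1; left.
      move=> _ [->|[y Uy <-]]; first by rewrite ge_min lexx.
      by rewrite ge_min; apply/orP; right; rewrite leNgt; apply/negP => /eU.
    apply: cvg_near_cst; near=> n; apply/min_idPr.
    rewrite (@le_trans _ _ (n%:R * e))//; last by rewrite ler_wpM2l.
    rewrite -ler_pdivrMr// mul1r; near: n; exact: nbhs_infty_ger.
  rewrite (_ : (fun n => _) = cst 0); first exact: cvg_cst.
  apply/funext => n; rewrite (_ : gap U x = 0) ?mulr0 ?min_l//.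
  apply/eqP; rewrite eq_le gap_ge0 andbT; apply: gap_le; right.
  by exists x => //; rewrite notin_setE in xU.
Unshelve. all: by end_near. Qed.

End Metrization.

Lemma normed_metrizes (R : realType) (V : normedModType R) :
  metrizes (fun x y : V => `|x - y|).
Proof.
split.
- by move=> x; rewrite subrr normr0.
- by move=> x y; rewrite distrC.
- by move=> x y z; rewrite ler_distD.
- by move=> x A; rewrite -nbhs_nbhs_norm; split => -[e e0 eA]; exists e.
Qed.

Section SecondCountable.

Lemma countable_bigcup_measurable d (T : measurableType d) (I : Type)
    (D : set I) (F : I -> set T) : countable D ->
  (forall i, D i -> measurable (F i)) -> measurable (\bigcup_(i in D) F i).
Proof.
move=> /countable_injP[f fi] mF.
rewrite (_ : \bigcup_(i in D) F i =
    \bigcup_n \bigcup_(i in D `&` [set i | f i = n]) F i); last first.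
  apply/seteqP; split => x [].
    by move=> i Di Fx; exists (f i) => //; exists i.
  by move=> n _ [i [Di _] Fx]; exists i.
apply: bigcupT_measurable => n.
have [[i Di fn]|h] := pselect (exists2 i, D i & f i = n).
  rewrite (_ : bigcup _ _ = F i); first exact: mF.
  apply/seteqP; split => x; last by move=> Fx; exists i.
  by move=> [l [Dl /= fl]]; rewrite (fi l i) ?inE// fn.
rewrite bigcup0// => i [Di fn]; exfalso; apply: h; by exists i.
Qed.

Lemma second_countable_prod (X Y : topologicalType) :
  @second_countable X -> @second_countable Y -> @second_countable (X * Y)%type.
Proof.
move=> [A cA [oA bA]] [B cB [oB bB]].
exists [set UV.1 `*` UV.2 | UV in A `*` B].
  by apply: (sub_countable (card_image_le _ _)); exact: countableX.
split=> [_ [[U V] [/= AU BV] <-]|[x y] W /= [[U V] /= [xU yV] UVW]].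
  rewrite openE => -[x y] [/= Ux Vy]; exists (U, V) => //=.
  by split; apply: open_nbhs_nbhs; split => //; [exact: oA|exact: oB].
have [U' [AU' U'x] U'U] := bA x U xU.
have [V' [BV' V'y] V'V] := bB y V yV.
exists (U' `*` V'); first by split; [exists (U', V')|].
by move=> [a b] [/= /U'U Ua /V'V Vb]; apply: UVW.
Qed.

(** An open set of a product of second countable spaces is a countable union of open boxes, and the
    preimage of a box is an intersection of two preimages. This brings the Borel sets of a product
    into the product sigma-algebra. *)
Lemma preimage_open_pair d (Z : measurableType d) (X Y : topologicalType)
    (p : Z -> X) (q : Z -> Y) :
  @second_countable X -> @second_countable Y ->
  (forall U, open U -> measurable (p @^-1` U)) ->
  (forall U, open U -> measurable (q @^-1` U)) ->
  forall U : set (X * Y), open U -> measurable ((fun z => (p z, q z)) @^-1` U).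
Proof.
move=> [A cA bA] [B cB bB] mp mq U oU.
rewrite (_ : _ @^-1` U = \bigcup_(UV in [set UV | (A `*` B) UV /\ UV.1 `*` UV.2 `<=` U])
    (p @^-1` UV.1 `&` q @^-1` UV.2)); last first.
  apply/seteqP; split => [z /= Uz|z [UV [_ UVU] [/= pz qz]]]; last exact: UVU.
  have : nbhs (p z, q z) U by apply: open_nbhs_nbhs.
  move=> [[V W] /= [pV qW] VWU].
  have [V' [AV' V'x] V'U] := bA.2 (p z) V pV.
  have [W' [BW' W'y] W'V] := bB.2 (q z) W qW.
  exists (V', W') => //; split => // -[a b] [/= /V'U Ua /W'V Vb].
  exact: VWU.
apply: countable_bigcup_measurable.
  by apply: sub_countable (countableX cA cB); apply: subset_card_le => UV [].
move=> UV [[AU BV] _]; apply: measurableI; first exact/mp/bA.1.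
exact/mq/bB.1.
Qed.

End SecondCountable.

Lemma rV_second_countable (R : realType) d : @second_countable 'rV[R]_d.
Proof.
apply: (metrizes_second_countable (@normed_metrizes R 'rV[R]_d)
  (A := range (fun u : 'rV[rat]_d => map_mx ratr u))).
  by apply: (sub_countable (card_image_le _ _)); exact: countableP.
move=> O [x Ox] oO.
have /nbhs_ballP[e /= e0 eO] : nbhs x O by exact: open_nbhs_nbhs.
have h (i : 'I_d) : exists q : rat, `|x 0 i - ratr q| < e.
  have [|y [yx [q _ qy]]] := @dense_rat R (ball (x 0 i) e) _ (ball_open _ _).
    by exists (x 0 i); exact: ballxx.
  by exists q; rewrite qy -ball_normE in yx *.
have [q hq] := choice h.
exists (map_mx ratr (\row_i q i)); split; last by exists (\row_i q i).
by apply: eO; split => // i j; rewrite ord1 !mxE -ball_normE/=.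
Qed.

Lemma real_second_countable (R : realType) : @second_countable R.
Proof.
apply: (metrizes_second_countable (@normed_metrizes R R^o) _ (@dense_rat R)).
by apply: (sub_countable (card_image_le _ _)); exact: countableP.
Qed.

Section NarrowKernel.
Context (R : realType) (X : ptopologicalType) d (V : measurableType d).
Variables (dist : X -> X -> R) (dm : metrizes dist).
Variables (D : set V) (mD : measurable D) (k : V -> probability (borel X) R).
Hypothesis mk : measurable_fun D (k : V -> borel (narrow_space R X)).

Lemma continuous_borel_measurable (f : X -> R) : continuous f ->
  measurable_fun setT (f : borel X -> R).
Proof.
move=> /continuousP cf; apply: (measurability _ (RGenOpens.measurableE R)).
move=> _ [_ [a [b ->]] <-]; rewrite setTI; apply: sub_sigma_algebra.
by apply: cf; exact: interval_open.
Qed.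

Lemma measurable_narrow_integral (f : X -> R) : continuous f -> bounded_fun f ->
  measurable_fun D (fun z => \int[k z]_x f x)%R.
Proof.
move=> cf bf; pose F : bounded_continuous R X := exist _ f (conj cf bf).
have cF : continuous (fun m : narrow_space R X => narrow_eval m F).
  have c1 := @initial_continuous _ _ (@narrow_eval R X).
  have c2 := @proj_continuous {classic bounded_continuous R X} (fun _ => R) F.
  move=> m; exact: (cvg_comp _ _ (c1 m) (c2 _)).
move=> _; apply: (measurability _ (RGenOpens.measurableE R)) => //.
move=> _ [_ [a [b ->]] <-].
have oU : open `]a, b[%classic by exact: interval_open.
have /continuousP/(_ _ oU) oF := cF.
have mO : measurable ((fun m : narrow_space R X => narrow_eval m F) @^-1` `]a, b[
    : set (borel (narrow_space R X))) by exact: sub_sigma_algebra.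
exact: (mk mD mO).
Qed.

(** The narrow topology controls integrals of bounded continuous functions only. Dominated
    convergence passes from these to open sets, and a Dynkin argument from open sets to all Borel
    sets. *)
Lemma narrow_kernel_measurable (A : set (borel X)) : measurable A ->
  measurable_fun D (fun z => k z A).
Proof.
move: A; apply: (@dynkin_induction _ (borel X) (@open X)) => //.
- exact: openI.
- rewrite (_ : (fun z => _) = cst 1%E); first exact: measurable_cst.
  by apply/funext => z; exact: probability_setT.
- move=> U oU; have [f [cf f01 fU]] := open_indic_limit dm oU.
  have mf n : measurable_fun setT (f n : borel X -> R) by exact: continuous_borel_measurable.
  have mU : measurable (U : set (borel X)) by exact: sub_sigma_algebra.
  apply: (@emeasurable_fun_cvg _ _ _ D (fun n z => \int[k z]_x (f n x)%:E)%E).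
    move=> n; have bf : bounded_fun (f n).
      exists 1; split => // M M1 x _; have /andP[f0 f1] := f01 n x.
      by rewrite /= ger0_norm// (le_trans f1)// ltW.
    have := measurable_narrow_integral (cf n) bf.
    move=> /measurable_EFinP; apply: eq_measurable_fun => z _ /=.
    rewrite /Rintegral fineK//; apply: integrable_fin_num => //.
    apply: (@le_integrable _ _ _ _ _ measurableT _ (cst 1%E)) => //.
    - exact/measurable_EFinP.
    - move=> x _ /=; have /andP[f0 f1] := f01 n x.
      by rewrite lee_fin normr1 ger0_norm.
    - exact: finite_measure_integrable_cst.
  move=> z Dz.
  have -> : k z U = (\int[k z]_x (\1_U x)%:E)%E by rewrite integral_indic// setIT.
  have [|||||_ _ h] := @dominated_convergence _ (borel X) R (k z) setT measurableT
    (fun n x => (f n x)%:E) (fun x => (\1_U x)%:E) (cst 1%E).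
  + by move=> n; exact/measurable_EFinP.
  + by apply/measurable_EFinP; exact: measurable_indic.
  + by apply: aeW => x _; apply/fine_cvgP; split; [exact: nearW|exact: fU].
  + exact: finite_measure_integrable_cst.
  + apply: aeW => x n _ /=; have /andP[f0 f1] := f01 n x.
    by rewrite lee_fin ger0_norm.
  + exact: h.
- move=> S mS mkS.
  rewrite (_ : (fun z => _) = (fun z => 1 - k z S)%E).
    by apply: emeasurable_funB => //; exact: measurable_cst.
  by apply/funext => z; rewrite probability_setC.
- move=> F mF tF mkF.
  apply: (@emeasurable_fun_cvg _ _ _ D (fun n z => \sum_(0 <= i < n) k z (F i))%E).
    by move=> n; exact: emeasurable_sum.
  move=> z Dz; apply: (@measure_semi_sigma_additive _ _ _ (k z)) => //.
  exact: bigcupT_measurable.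
Qed.

End NarrowKernel.

(** * The test functions *)

Section EuclideanNorm.
Context (R : realType) (d : nat).
Local Notation E := 'rV[R]_d.
Implicit Types u w x : E.

Lemma enorm_ge0 u : 0 <= enorm u. Proof. exact: sqrtr_ge0. Qed.

Lemma coord_le_norm u i : `|u 0 i| <= `|u|.
Proof.
rewrite [leRHS]mx_normrE.
exact: (le_bigmax _ (fun ij : 'I_1 * 'I_d => `|u ij.1 ij.2|) (0, i)).
Qed.

Lemma coord_le_enorm u i : `|u 0 i| <= enorm u.
Proof.
rewrite -sqrtr_sqr /enorm ler_sqrt; last first.
  by apply: sumr_ge0 => l _; rewrite -expr2 sqr_ge0.
rewrite /dotv (bigD1 i)//= -expr2 lerDl.
by apply: sumr_ge0 => l _; rewrite -expr2 sqr_ge0.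
Qed.

(** The norms are mixed on purpose: gradients are measured in the sup norm of the jet, the field in
    the Euclidean norm of the growth bound. *)
Lemma dotv_le u w : `|dotv u w| <= d%:R * `|u| * enorm w.
Proof.
rewrite /dotv (le_trans (ler_norm_sum _ _ _))//.
apply: (@le_trans _ _ (\sum_(i < d) `|u| * enorm w)).
  by apply: ler_sum => i _; rewrite normrM ler_pM// ?coord_le_norm ?coord_le_enorm.
by rewrite sumr_const card_ord -mulrA mulr_natl.
Qed.

Lemma enorm_le u : enorm u <= d%:R * `|u|.
Proof.
rewrite /enorm -[leRHS]ger0_norm ?mulr_ge0// -sqrtr_sqr ler_sqrt ?sqr_ge0//.
rewrite /dotv; apply: (@le_trans _ _ (\sum_(i < d) `|u| ^+ 2)).
  apply: ler_sum => i _; rewrite -expr2 -real_normK ?num_real//.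
  by rewrite lerXn2r ?nnegrE// coord_le_norm.
rewrite sumr_const card_ord exprMn -[X in X <= _]mulr_natl ler_wpM2r ?sqr_ge0//.
by rewrite -natrX ler_nat; case: d => // n; rewrite expnS leq_pmulr.
Qed.

Lemma dotvZl a u w : dotv (a *: u) w = a * dotv u w.
Proof. by rewrite /dotv mulr_sumr; apply: eq_bigr => i _; rewrite mxE mulrA. Qed.

Lemma dotvBl u u' w : dotv (u - u') w = dotv u w - dotv u' w.
Proof.
by rewrite /dotv -sumrB; apply: eq_bigr => i _; rewrite !mxE mulrBl.
Qed.

Lemma dotv0l w : dotv 0 w = 0.
Proof. by rewrite /dotv big1// => i _; rewrite mxE mul0r. Qed.

End EuclideanNorm.

Section DirectionalMeanValue.
Context (R : realType) (V : normedModType R).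

Lemma derivable_line (f : V -> R) (y v : V) (s : R) :
  derivable f (y + s *: v) v ->
  is_derive s 1 (fun s => f (y + s *: v)) ('D_v f (y + s *: v)).
Proof.
have E : (fun h : R => h^-1 *: ((f \o shift (y + s *: v)) (h *: v) - f (y + s *: v))) =
  (fun h : R => h^-1 *: (((fun s => f (y + s *: v)) \o shift s) (h *: (1 : R)) - f (y + s *: v))).
  apply/funext => h /=; congr (_ *: (f _ - _)).
  by rewrite (_ : h *: (1 : R) = h) ?scalerDl 1?addrCA//; exact: mulr1.
by rewrite /derivable /derive E => df; split.
Qed.

Lemma derive_lipschitz (f : V -> R) (y v : V) (s M : R) :
  (forall x, derivable f x v) -> (forall x, `|'D_v f x| <= M) ->
  `|f (y + s *: v) - f y| <= M * `|s|.
Proof.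
move=> df dM; pose h s := f (y + s *: v).
have dh (t : R) : is_derive t (1 : R) h ('D_v f (y + t *: v)) by exact: derivable_line.
have ch : continuous h.
  by move=> t; apply/differentiable_continuous/derivable1_diffP; case: (dh t).
have h0 : h 0 = f y by rewrite /h scale0r addr0.
rewrite -/(h s) -h0.
have [s0|s0] := leP 0 s.
  have [c _ ->] := MVT_segment s0 (fun x _ => dh x) (continuous_subspaceT ch).
  by rewrite normrM subr0 ler_wpM2r.
rewrite distrC.
have [c _ ->] := MVT_segment (ltW s0) (fun x _ => dh x) (continuous_subspaceT ch).
by rewrite normrM sub0r normrN ler_wpM2r.
Qed.

Lemma derive_seq (f : V -> R) (a v : V) : derivable f a v ->
  (fun n => n.+1%:R * (f (n.+1%:R^-1 *: v + a) - f a)) @ \oo --> 'D_v f a.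
Proof.
move=> df.
have h : (fun n : nat => n.+1%:R^-1 : R) @ \oo --> 0^'.
  move=> A /= /nbhs_ballP[e /= e0 eA].
  have := @near_infty_natSinv_lt R (PosNum e0); apply: filterS => n ne.
  apply: eA; last by rewrite gt_eqF.
  by rewrite -ball_normE/= sub0r normrN ger0_norm.
have := cvg_comp _ _ h df; rewrite /=; apply: cvg_trans.
apply: near_eq_cvg; apply: nearW => n /=.
by rewrite invrK [LHS]mulrC mulrC.
Qed.

End DirectionalMeanValue.

Section C1cTheory.
Context (R : realType) (d : nat).
Local Notation E := 'rV[R]_d.
Implicit Types (g : R -> E -> R) (T : R).

(** The first-order data of [g], all that [transport] sees of it. The norm of the pair is the larger
    of the two norms. *)
Definition jet g (q : R * E) : R * E := (dtime g q.1 q.2, grad g q.1 q.2).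

Definition supp g : set (R * E) := closure [set q : R * E | g q.1 q.2 != 0].

Lemma jet_continuous g : is_C1 g -> continuous (jet g).
Proof. by case=> _ _ c1 c2 q; exact: (cvg_pair (c1 q) (c2 q)). Qed.

Lemma grad_coord g t x i : grad g t x 0 i = 'D_(delta_mx 0 i) (g t) x.
Proof. by rewrite /grad mxE. Qed.

Lemma out_supp g q : ~ supp g q -> g q.1 q.2 = 0.
Proof.
move=> gq; apply/eqP; apply: contrapT => h; apply: gq; apply: subset_closure.
exact/negP.
Qed.

Lemma near_out_supp g q : ~ supp g q -> \forall p \near q, g p.1 p.2 = 0.
Proof.
move=> gq; have : open (~` supp g) by apply: closed_openC; exact: closed_closure.
rewrite openE => /(_ q gq); apply: filterS => p; exact: out_supp.
Qed.

Lemma jet_out_supp g q : ~ supp g q -> jet g q = 0.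
Proof.
case: q => t x /near_out_supp gq; rewrite /jet/=; congr pair.
  rewrite /dtime (@near_eq_derive _ _ _ _ (cst 0)) ?derive_cst//.
  have /(_ _ gq) : (fun s : R => (s, x)) @ t --> (t, x).
    exact: (@cvg_pair _ _ _ (nbhs t) (nbhs t) (nbhs x) _ _ _ id (cst x)
      (@cvg_id _ _) (cvg_cst x)).
  by move=> h; exact: h.
apply/rowP => i; rewrite grad_coord mxE.
rewrite (@near_eq_derive _ _ _ _ (cst 0)) ?derive_cst//.
have /(_ _ gq) : (fun y : E => (t, y)) @ x --> (t, x).
  exact: (@cvg_pair _ _ _ (nbhs x) (nbhs t) (nbhs x) _ _ _ (cst t) id
    (cvg_cst t) (@cvg_id _ _)).
by move=> h; exact: h.
Qed.

Lemma compact_support_bounded (V : normedModType R) (f : R * E -> V) (K : set (R * E)) :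
  compact K -> continuous f -> (forall q, ~ K q -> f q = 0) ->
  exists2 M : R, 0 <= M & forall q, `|f q| <= M.
Proof.
move=> cK cf f0.
have cfK : compact (f @` K).
  by apply: continuous_compact => //; exact: continuous_subspaceT.
have [M0 [_ hM]] := compact_bounded cfK.
exists (Num.max 0 (M0 + 1)); first by rewrite le_max lexx.
move=> q; have [Kq|Kq] := pselect (K q).
  rewrite le_max; apply/orP; right; apply: (hM (M0 + 1)); first by rewrite ltrDl.
  by exists q.
by rewrite f0// normr0 le_max lexx.
Qed.

Lemma C1c_jet_bounded T g : C1c T g ->
  exists2 M : R, 0 <= M & forall t x, `|dtime g t x| <= M /\ `|grad g t x| <= M.
Proof.
move=> [g1 cg _].
have [M M0 hM] := compact_support_bounded cg (jet_continuous g1) (@jet_out_supp g).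
exists M => // t x; have := hM (t, x).
by rewrite /jet/= prod_normE/= ge_max => /andP.
Qed.

Lemma C1c_supp_bounded T g : C1c T g ->
  exists n : nat, forall t x, n%:R < `|x| -> jet g (t, x) = 0.
Proof.
move=> [_ cg _]; have [M0 [_ hM]] := compact_bounded cg.
have [n Mn] : exists n : nat, M0 < n%:R.
  by exists (Num.truncn M0).+1; exact: truncnS_gt.
exists n => t x nx; apply: jet_out_supp => /(hM _ Mn) /=.
rewrite prod_normE/= ge_max => /andP[_].
by rewrite leNgt nx.
Qed.

Lemma C1c_time_out T g t x : C1c T g -> ~ (0 < t < T) ->
  g t x = 0 /\ jet g (t, x) = 0.
Proof.
move=> [_ _ sg] tT; have h : ~ supp g (t, x) by move=> /sg.
by split; [exact: (out_supp h)|exact: jet_out_supp].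
Qed.

(** Only partial derivatives are given, so the increment is split into moves along the coordinate
    axes, each estimated by the mean value theorem. *)
Lemma grad_lipschitz (f : E -> R) (M : R) (x y : E) :
  (forall x i, derivable f x (delta_mx 0 i)) ->
  (forall x i, `|'D_(delta_mx 0 i) f x| <= M) ->
  `|f x - f y| <= M * \sum_i `|(x - y) 0 i|.
Proof.
move=> df dM.
have -> : f x = f (y + \sum_i (x - y) 0 i *: delta_mx 0 i).
  by rewrite -row_sum_delta addrC subrK.
elim: (index_enum _) => [|i s IHs]; first by rewrite !big_nil addr0 subrr normr0 mulr0.
rewrite !big_cons mulrDr.
rewrite [X in y + X]addrC addrA.
set z := y + _.
rewrite -(subrK (f z) (f (z + _))) -addrA (le_trans (ler_normD _ _))// lerD//.
by apply: derive_lipschitz => // u.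
Qed.

(** [is_C1] asks for partial derivatives and their continuity; joint continuity of [g] follows
    because compact support bounds the partials and makes [g] Lipschitz. *)
Lemma C1c_continuous T g : C1c T g -> continuous (fun q : R * E => g q.1 q.2).
Proof.
move=> gC; have [M M0 hM] := C1c_jet_bounded gC.
have [[dt dx _ _] _ _] := gC.
move=> [t0 x0]; apply/cvgrPdist_le => e e0 /=.
have lip t x : `|g t0 x0 - g t x| <= M * (`|t0 - t| + d%:R * `|x0 - x|).
  rewrite -(subrK (g t x0) (g t0 x0)) -addrA (le_trans (ler_normD _ _))//.
  rewrite mulrDr lerD//.
    have := @derive_lipschitz R R (g ^~ x0) t 1 (t0 - t) M (fun s => dt s x0)
      (fun s => (hM s x0).1).
    by rewrite (_ : (t0 - t) *: (1 : R) = t0 - t) ?subrKC//; exact: mulr1.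
  have gM y i : `|'D_(delta_mx 0 i) (g t) y| <= M.
    by rewrite -grad_coord (le_trans (coord_le_norm _ _))//; exact: (hM t y).2.
  rewrite (le_trans (grad_lipschitz x0 x (dx t) gM))//.
  rewrite ler_wpM2l// (le_trans (ler_sum _ (fun i _ => coord_le_norm (x0 - x) i)))//.
  by rewrite sumr_const card_ord mulr_natl.
pose K := M * (1 + d%:R) + 1.
have K0 : 0 < K by rewrite ltr_wpDl// mulr_ge0// addr_ge0.
have eK : 0 < e / K by rewrite divr_gt0.
have := @nbhsx_ballx _ (R * E)%type (t0, x0) (e / K) eK.
apply: filterS => -[t x] [/= bt bx].
rewrite (le_trans (lip t x))//.
move: bt bx; rewrite -!ball_normE/= => bt bx.
apply: (@le_trans _ _ (M * (e / K + d%:R * (e / K)))).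
  by rewrite ler_wpM2l// lerD// ?ler_wpM2l// ltW.
have -> : M * (e / K + d%:R * (e / K)) = M * (1 + d%:R) * e / K by ring.
by rewrite ler_pdivrMr// mulrC ler_wpM2l ?(ltW e0)// lerDl.
Qed.

Lemma C1c_bounded T g : C1c T g -> exists2 M : R, 0 <= M & forall t x, `|g t x| <= M.
Proof.
move=> gC; have [M M0 hM] := compact_support_bounded (let: And3 _ c _ := gC in c)
  (C1c_continuous gC : continuous (_ : R * E -> R^o)) (@out_supp g).
by exists M => // t x; exact: hM (t, x).
Qed.

Lemma dtimeZ g c t x : derivable (g ^~ x) t 1 ->
  dtime (fun t x => c * g t x) t x = c * dtime g t x.
Proof. by move=> dg; exact: (deriveZ c dg). Qed.

Lemma gradZ g c t x : (forall i, derivable (g t) x (delta_mx 0 i)) ->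
  grad (fun t x => c * g t x) t x = c *: grad g t x.
Proof.
by move=> dg; apply/rowP => i; rewrite !mxE; exact: (deriveZ c (dg i)).
Qed.

Lemma C1cZ T g c : C1c T g -> C1c T (fun t x => c * g t x).
Proof.
move=> [[dt dx ct cx] cg sg].
have sub : supp (fun t x => c * g t x) `<=` supp g.
  apply: closureS => q /=; apply: contra_neq => ->; exact: mulr0.
split; last by move=> q /sub /sg.
- split.
  + by move=> t x; exact: (@derivableZ _ _ _ _ c _ _ (dt t x)).
  + by move=> t x i; exact: (@derivableZ _ _ _ _ c _ _ (dx t x i)).
  + rewrite (_ : (fun q => _) = (fun q => c * dtime g q.1 q.2)).
      by move=> q; apply: cvgM; [exact: cvg_cst|exact: ct].
    by apply/funext => q; rewrite dtimeZ.
  + rewrite (_ : (fun q => _) = (fun q => c *: grad g q.1 q.2)).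
      by move=> q; apply: cvgZ; [exact: cvg_cst|exact: cx].
    by apply/funext => q; rewrite gradZ.
- apply: subclosed_compact cg sub; exact: closed_closure.
Qed.

Lemma C1c0 T : C1c T (fun (_ : R) (_ : E) => 0 : R).
Proof.
have s0 : supp (fun (_ : R) (_ : E) => 0 : R) = set0.
  rewrite /supp (_ : [set _ | _] = set0) ?closure0//.
  by apply/seteqP; split => q //=; rewrite eqxx.
suff: [/\ is_C1 (fun (_ : R) (_ : E) => 0 : R), compact (supp (fun (_ : R) (_ : E) => 0 : R)) &
    supp (fun (_ : R) (_ : E) => 0 : R) `<=` [set q | 0 < q.1 < T]] by [].
rewrite s0; split => //; last exact: compact0.
split.
- by move=> t x; exact: derivable_cst.
- by move=> t x i; exact: derivable_cst.
- rewrite (_ : (fun q => _) = cst 0); first exact: cst_continuous.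
  by apply/funext => q; rewrite /dtime derive_cst.
- rewrite (_ : (fun q => _) = cst 0); first exact: cst_continuous.
  by apply/funext => q; apply/rowP => i; rewrite grad_coord derive_cst mxE.
Qed.

End C1cTheory.

(** * A countable approximating family of test functions *)

Lemma second_countable_enum (X : topologicalType) : @second_countable X ->
  exists e : nat -> set X, (forall n, open (e n)) /\
    forall x U, nbhs x U -> exists n, e n x /\ e n `<=` U.
Proof.
move=> [B /countable_injP[c ci] [oB bB]].
exists (fun n => \bigcup_(V in B `&` [set V | c V = n]) V); split.
  by move=> n; apply: bigcup_open => V [BV _]; exact: oB.
move=> x U /(bB x)[V [BV Vx] VU]; exists (c V).
split; first by exists V.
by move=> y [W [BW /= WV] Wy]; apply: VU; rewrite -(ci W V) ?inE.
Qed.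

Section CountableDenseFamily.
Context (R : realType) (d : nat) (T : R).
Local Notation E := 'rV[R]_d.
Local Notation index := (nat * nat * seq (nat * nat))%type.

Let countable_base : exists e : nat -> set (R * E), (forall n, open (e n)) /\
    forall x U, nbhs x U -> exists n, e n x /\ e n `<=` U.
Proof.
apply: second_countable_enum; apply: second_countable_prod.
  exact: real_second_countable.
exact: rV_second_countable.
Qed.

(* The code [(n, m, l)] records the following about [g]: its support is in
   norm at most [n], each pair [(a, b)] of [l] means that the jet maps the
   [a]-th basic open set into the [b]-th one, which has diameter at most
   [1/(m+1)], and the jet vanishes outside the basic sets listed in [l].  Two
   functions with the same code have jets uniformly [1/(m+1)]-close. *)
Lemma C1c_countable_dense : exists G : index -> R -> E -> R,
  (forall i, C1c T (G i)) /\
  forall g, C1c T g -> exists n : nat, forall e, 0 < e -> exists i,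
    (forall t x, n%:R < `|x| -> jet g (t, x) = 0 /\ jet (G i) (t, x) = 0) /\
    forall q, `|jet g q - jet (G i) q| <= e.
Proof.
have [e [oe be]] := countable_base.
pose P (i : index) (g : R -> E -> R) := [/\ C1c T g,
  forall t x, i.1.1%:R < `|x| -> jet g (t, x) = 0,
  forall a b, (a, b) \in i.2 -> (forall q, e a q -> e b (jet g q)) /\
    forall y y', e b y -> e b y' -> `|y - y'| <= i.1.2.+1%:R^-1 &
  forall q, (forall a b, (a, b) \in i.2 -> ~ e a q) -> jet g q = 0].
have /choice[G hG] : forall i, exists g, C1c T g /\ ((exists g, P i g) -> P i g).
  move=> i; have [[g Pg]|h] := pselect (exists g, P i g).
    by exists g; split => //; case: Pg.
  (* A code that describes no test function is given the zero function, so that every member of the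
     family is a test function. *)
  exists (fun _ _ => 0); split; first exact: C1c0.
  by move=> h'; exfalso; apply: h.
exists G; split; first by move=> i; case: (hG i).
move=> g gC; have [n gn] := C1c_supp_bounded gC; exists n => eps eps0.
have [m meps] : exists m : nat, m.+1%:R^-1 <= eps.
  have [m _ h] := @near_infty_natSinv_lt R (PosNum eps0).
  by exists m; apply/ltW/(h m) => /=.
suff [l Pl] : exists l, P (n, m, l) g.
  have [_ /(_ (ex_intro _ g Pl))[_ Gn Gl G0]] := hG (n, m, l).
  have [_ _ gl g0] := Pl.
  exists (n, m, l); split; first by move=> t x nx; split; [exact: gn|exact: Gn].
  move=> q; have [[a [b [abl eaq]]]|h] := pselect (exists a b, (a, b) \in l /\ e a q).
    apply: le_trans meps; have [h1 h2] := gl a b abl.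
    by apply: h2; [exact: h1|exact: (Gl a b abl).1].
  have h' a b : (a, b) \in l -> ~ e a q by move=> abl eaq; apply: h; exists a, b.
  by rewrite g0// G0// subrr normr0 ltW.
have [g1 cg _] := gC.
pose ok (ab : nat * nat) := (forall q, e ab.1 q -> e ab.2 (jet g q)) /\
  forall y y', e ab.2 y -> e ab.2 y' -> `|y - y'| <= m.+1%:R^-1.
(* First a basic set around the value of the jet, inside a ball of half the allowed diameter; then,
   by continuity, a basic set around [q] that the jet maps into it. *)
have hq q : exists ab, ok ab /\ e ab.1 q.
  have m0 : 0 < (m.+1%:R^-1 : R) / 2 by rewrite divr_gt0.
  have [b [bq bm]] := be (jet g q) _ (@nbhsx_ballx _ (R * E)%type (jet g q) _ m0).
  have /(be q) [a [aq ab]] : nbhs q (jet g @^-1` (e b)).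
    by apply: (jet_continuous g1); apply: open_nbhs_nbhs; split.
  exists (a, b); split=> //; split => [//|y y' /bm + /bm].
  rewrite -ball_normE/= => yq y'q.
  rewrite (le_trans (ler_distD (jet g q) y y'))// (splitr m.+1%:R^-1) lerD// ltW//.
  by rewrite distrC.
(* Compactness of the support leaves a finite list of pairs; off the sets it lists, the jet
   vanishes. *)
move: cg; rewrite compact_cover => /(_ _ [set ab | ok ab] (fun ab => e ab.1)).
case=> [ab _|q _|D' D'ok cov]; first exact: oe.
  by have [ab [okab eq]] := hq q; exists ab.
exists (finmap.enum_fset D'); split => // [a b abD'|q hl].
  by have := D'ok (a, b) abD'; rewrite in_setE.
apply: jet_out_supp => /cov[[a b] /= abD'].
exact: (hl a b abD').
Qed.

End CountableDenseFamily.

(** * Disintegration of nonnegative functions *)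

Section DisintegrationNonneg.
Local Open Scope ereal_scope.
Context dw dy dz (W : measurableType dw) (Y : measurableType dy)
  (Z : measurableType dz) (R : realType) (P : probability W R).
Variables (j : Z -> W * Y) (mj : measurable_fun setT j).
Variables (m : probability Z R) (k : W -> probability Y R).
Hypothesis mk : forall U, measurable U -> measurable_fun setT (fun w => k w U).
Import HBNNSimple.

(** Simple functions are bounded, so the identity holds for the approximations of [f]; monotone
    convergence is then used once on the left and twice, inside and outside, on the right. *)
Lemma ge0_disintegration :
  (forall f : W * Y -> R, measurable_fun setT f -> bounded_fun f ->
    \int[m]_z (f (j z))%:E = \int[P]_w \int[k w]_y (f (w, y))%:E) ->
  forall f : W * Y -> \bar R, measurable_fun setT f -> (forall z, 0 <= f z) ->
  \int[m]_z f (j z) = \int[P]_w \int[k w]_y f (w, y).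
Proof.
move=> dis f mf f0; pose g := nnsfun_approx measurableT mf.
have gf z : EFin \o g ^~ z @ \oo --> f z by exact: cvg_nnsfun_approx.
have ndg z : nondecreasing_seq (fun n => (g n z)%:E).
  by move=> a b ab; rewrite lee_fin; exact/lefP/nd_nnsfun_approx.
have mg n : measurable_fun setT (g n) by [].
have mgE n : measurable_fun setT (fun z => (g n z)%:E) by exact/measurable_EFinP.
have g0 n z : 0 <= (g n z)%:E by rewrite lee_fin; exact: fun_ge0.
have bg n : bounded_fun (g n).
  exact: simple_bounded.
have sec w n : measurable_fun setT (fun y => (g n (w, y))%:E).
  exact: (measurableT_comp (mgE n) (pair1_measurable w)).
transitivity (limn (fun n => \int[m]_z (g n (j z))%:E)).
  rewrite -monotone_convergence//.
  - by apply: eq_integral => z _; apply/esym/cvg_lim => //; exact: gf.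
  - by move=> n; exact: (measurableT_comp (mgE n) mj).
transitivity (limn (fun n => \int[P]_w \int[k w]_y (g n (w, y))%:E)).
  by congr (limn _); apply/funext => n; exact: (dis _ (mg n) (bg n)).
rewrite -monotone_convergence//.
- apply: eq_integral => w _; rewrite -monotone_convergence//.
  + by apply: eq_integral => y _; apply/cvg_lim => //; exact: gf.
- move=> n; apply: (@kernel_integral_measurable_ge0 _ _ W Y R k mk (fun z => (g n z)%:E)) => //.
- by move=> n w _; exact: integral_ge0.
- move=> w _ a b ab; apply: ge0_le_integral => //.
  by move=> y _; exact: ndg.
Qed.

End DisintegrationNonneg.

(** * Joint measurability in time, parameter and space *)

Section BorelProducts.
Context (R : realType) (X : topologicalType).

Lemma polish_metrizes : polish_space R X -> exists dist : X -> X -> R, metrizes dist.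
Proof.
move=> [_ [dist [d0 ds dt dn _]]]; exists dist; split => //.
by move=> x; apply/d0.
Qed.

Lemma polish_second_countable : polish_space R X -> @second_countable X.
Proof.
move=> pX; have [[A cA dA] _] := pX; have [dist dm] := polish_metrizes pX.
exact: (metrizes_second_countable dm cA dA).
Qed.

End BorelProducts.

Lemma borel_measurable_fun d (Z : measurableType d) (X : ptopologicalType)
    (f : Z -> borel X) :
  (forall U : set X, open U -> measurable (f @^-1` U)) -> measurable_fun setT f.
Proof.
move=> mf; apply: (@measurability _ _ Z (borel X) setT f (@open X)) => //.
by move=> _ [U oU <-]; rewrite setTI; exact: mf.
Qed.

(** The identity map, viewed from the Borel sigma-algebra of the product to the product of the Borel
    sigma-algebras: [disintegration] is stated on the former, Fubini needs the latter. *)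
Definition borel_pair (X Y : ptopologicalType) (p : borel (X * Y)%type) :
  borel X * borel Y := p.

Lemma borel_pair_measurable (X Y : ptopologicalType) :
  measurable_fun setT (@borel_pair X Y).
Proof.
apply/measurable_fun_pairP; split; apply: borel_measurable_fun => U oU;
  apply: sub_sigma_algebra.
- have /continuousP : continuous (@fst X Y) by move=> q; exact: cvg_fst.
  exact.
- have /continuousP : continuous (@snd X Y) by move=> q; exact: cvg_snd.
  exact.
Qed.

Section SpaceTime.
Context (R : realType) (Omega : ptopologicalType) (d : nat).
Local Notation E := 'rV[R]_d.
Local Notation Z := (measurableTypeR R * borel Omega * borel E)%type.

Lemma preimage_open_space_time : @second_countable Omega ->
  forall U : set (R * Omega * E), open U -> measurable (U : set Z).
Proof.
move=> sO U oU.
rewrite (_ : U = (fun z : Z => (z.1, z.2)) @^-1` U); last by apply/seteqP; split => -[].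
move: U oU; apply: (@preimage_open_pair _ Z (R * Omega)%type E fst snd).
- by apply: second_countable_prod => //; exact: real_second_countable.
- exact: rV_second_countable.
- move=> U oU; rewrite (_ : _ @^-1` U = (fun z : Z => (z.1.1, z.1.2)) @^-1` U); last first.
    by apply/seteqP; split => -[[]].
  move: U oU; apply: (@preimage_open_pair _ Z R Omega (fst \o fst) (snd \o fst)) => //.
  + exact: real_second_countable.
  + move=> U /open_measurable mU; rewrite -[X in measurable X]setTI.
    by apply: (measurableT_comp measurable_fst measurable_fst).
  + move=> U oU; rewrite -[X in measurable X]setTI.
    have mU : measurable (U : set (borel Omega)) by exact: sub_sigma_algebra.
    by apply: (measurableT_comp measurable_snd measurable_fst).
- move=> U oU; rewrite -[X in measurable X]setTI.
  have mU : measurable (U : set (borel E)) by exact: sub_sigma_algebra.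
  exact: measurable_snd.
Qed.

Lemma preimage_open_time_space (U : set (R * E)) : open U ->
  measurable ((fun z : Z => (z.1.1, z.2)) @^-1` U).
Proof.
apply: (@preimage_open_pair _ Z R E (fst \o fst) snd).
- exact: real_second_countable.
- exact: rV_second_countable.
- move=> {}U /open_measurable mU; rewrite -[X in measurable X]setTI.
  by apply: (measurableT_comp measurable_fst measurable_fst).
- move=> {}U oU; rewrite -[X in measurable X]setTI.
  have mU : measurable (U : set (borel E)) by exact: sub_sigma_algebra.
  exact: measurable_snd.
Qed.

Lemma measurable_fun_opens d' (S : measurableType d') (D : set S) (f : S -> R) :
  (forall U : set R, open U -> measurable (D `&` f @^-1` U)) -> measurable_fun D f.
Proof.
move=> mf mD; apply: (measurability _ (RGenOpens.measurableE R)) => //.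
by move=> _ [_ [a [b ->]] <-]; apply: mf; exact: interval_open.
Qed.

Lemma continuous_time_space_measurable (f : R * E -> R) : continuous f ->
  measurable_fun setT (fun z : Z => f (z.1.1, z.2)).
Proof.
move=> /continuousP cf; apply: measurable_fun_opens => U /cf oU; rewrite setTI.
exact: (preimage_open_time_space oU).
Qed.

(** Continuity is known over [[0, T]] only; for the other times the support condition makes [phi]
    vanish, so [phi] is the extension by 0 of its restriction. *)
Lemma Adm_measurable (T : R) (phi : R -> Omega -> E -> R) :
  @second_countable Omega -> Adm T phi ->
  measurable_fun setT (fun z : Z => phi z.1.1 z.1.2 z.2).
Proof.
move=> sO [cphi _ phiC _].
pose D := [set p : R * Omega * E | p.1.1 \in `[0, T]].
have mD : measurable (D : set Z).
  rewrite (_ : D = (fst \o fst : Z -> R) @^-1` `[0, T]%classic)//.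
  rewrite -[X in measurable X]setTI.
  by apply: (measurableT_comp measurable_fst measurable_fst).
have mf : measurable_fun (D : set Z) (fun z : Z => phi z.1.1 z.1.2 z.2).
  apply: measurable_fun_opens => U oU.
  move/continuousP : cphi => cphi; have [V oV VD] := (open_subspaceP _ _).1 (cphi U oU).
  rewrite setIC -VD; apply: measurableI => //.
  exact: preimage_open_space_time.
rewrite (_ : (fun z => _) = ((fun z : Z => phi z.1.1 z.1.2 z.2) \_ D)).
  apply/(measurable_restrict _ mD measurableT).
  by apply: measurable_funS mf.
apply/funext => z; rewrite patchE; case: ifPn => // /negP zD.
have tT : ~ (0 < z.1.1 < T).
  move=> /andP[t0 tT]; apply: zD; rewrite inE /D/= in_itv/=.
  by rewrite (ltW t0) (ltW tT).
exact: (C1c_time_out z.2 (phiC z.1.2) tT).1.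
Qed.

(** [Adm] gives no continuity in the parameter for the derivatives. Their joint measurability comes
    from difference quotients of [phi] along the steps 1/(n+1), with [s h] shifting one variable by
    [h]. *)
Lemma measurable_derive (f : Z -> R) (df : Z -> R) (s : R -> Z -> Z) :
  measurable_fun setT f -> (forall h, measurable_fun setT (s h)) ->
  (forall z, (fun n => n.+1%:R * (f (s n.+1%:R^-1 z) - f z)) @ \oo --> df z) ->
  measurable_fun setT df.
Proof.
move=> mf ms hdf.
apply: (@measurable_fun_cvg _ Z R setT
  (fun n z => n.+1%:R * (f (s n.+1%:R^-1 z) - f z))); last by move=> z _; exact: hdf.
move=> n; apply: measurable_funM; first exact: measurable_cst.
apply: measurable_funB => //; exact: (measurableT_comp mf (ms _)).
Qed.

Lemma Adm_dtime_measurable (T : R) (phi : R -> Omega -> E -> R) :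
  @second_countable Omega -> Adm T phi ->
  measurable_fun setT (fun z : Z => dtime (fun t => phi t z.1.2) z.1.1 z.2).
Proof.
move=> sO A; have [_ _ phiC _] := A.
apply: (measurable_derive (Adm_measurable sO A)
  (s := fun h z => ((h *: (1 : R) + z.1.1, z.1.2), z.2))).
  move=> h; apply: measurable_fun_pair => //; apply: measurable_fun_pair.
    apply: measurable_funD; first exact: measurable_cst.
    exact: (measurableT_comp measurable_fst measurable_fst).
  exact: (measurableT_comp measurable_snd measurable_fst).
move=> z; have [[dt _ _ _] _ _] := phiC z.1.2.
exact: (derive_seq (dt z.1.1 z.2)).
Qed.

Lemma Adm_grad_measurable (T : R) (phi : R -> Omega -> E -> R) (i : 'I_d) :
  @second_countable Omega -> Adm T phi ->
  measurable_fun setT (fun z : Z => grad (fun t => phi t z.1.2) z.1.1 z.2 0 i).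
Proof.
move=> sO A; have [_ _ phiC _] := A.
apply: (measurable_derive (Adm_measurable sO A)
  (s := fun h z => (z.1, h *: delta_mx 0 i + z.2))).
  move=> h; apply: measurable_fun_pair => //.
  have ms : measurable_fun setT ((fun x => h *: delta_mx 0 i + x) : borel E -> borel E).
    apply: borel_measurable_fun => U oU; apply: sub_sigma_algebra.
    have /continuousP : continuous (fun x : E => h *: delta_mx 0 i + x).
      by move=> x; exact: (cvgD (cvg_cst (h *: delta_mx 0 i)) (@cvg_id _ (nbhs x))).
    exact.
  exact: (measurableT_comp ms measurable_snd).
move=> z; have [[_ dx _ _] _ _] := phiC z.1.2.
rewrite grad_coord; exact: (derive_seq (dx z.1.1 z.2 i)).
Qed.

End SpaceTime.

(** * The continuity equation *)

Section CommonSetting.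
Context (R : realType) (Omega : ptopologicalType)
  (mpi : probability (borel Omega) R) (T : R) (d : nat).
Local Notation E := 'rV[R]_d.
Local Notation W := (borel Omega).
Local Notation Y := (borel E).
Local Notation X := (measurableTypeR R).
Local Notation Z := (X * W * Y)%type.
Local Notation lam := (@lebesgue_measure R).
Implicit Types (v : R -> Omega -> E -> E).

(* [v] is only measurable for the completed sigma-algebra; removing a null set
   [N] of times and parameters makes it Borel without changing any of the
   integrals at stake. *)
Definition restrict_field (N : set (X * W)) v : R -> Omega -> E -> E :=
  fun t w x => if (t \in `[0, T]) && ((t, w) \notin N) then v t w x else 0.

Definition measurable_field v : Prop :=
  forall i, measurable_fun setT (fun z : Z => v z.1.1 z.1.2 z.2 0 i).

Let mtime : measurable ([set z : Z | z.1.1 \in `[0, T]]).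
Proof.
rewrite (_ : [set _ | _] = (fst \o fst : Z -> R) @^-1` `[0, T]%classic)//.
rewrite -[X in measurable X]setTI.
by apply: (measurableT_comp measurable_fst measurable_fst).
Qed.

Lemma coord_measurable (i : 'I_d) : measurable_fun setT (fun x : Y => x 0 i).
Proof. by apply: continuous_borel_measurable => x; exact: coord_continuous. Qed.

Lemma restrict_field_measurable (N : set (X * W)) v : measurable N ->
  (forall i, measurable_fun ([set z : Z | z.1.1 \in `[0, T]] `\` fst @^-1` N)
    (fun z : Z => v z.1.1 z.1.2 z.2 0 i)) ->
  measurable_field (restrict_field N v).
Proof.
move=> mN mv i.
have mD : measurable ([set z : Z | z.1.1 \in `[0, T]] `\` fst @^-1` N).
  apply: measurableD => //.
  by rewrite -[X in measurable X]setTI; exact: measurable_fst.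
rewrite (_ : (fun z => _) = ((fun z : Z => v z.1.1 z.1.2 z.2 0 i) \_
    ([set z : Z | z.1.1 \in `[0, T]] `\` fst @^-1` N))).
  by apply/(measurable_restrict _ mD measurableT); exact: measurable_funS (mv i).
apply/funext => -[[t w] x]; rewrite /restrict_field patchE/=.
rewrite (_ : ((t, w, x) \in _) = (t \in `[0, T]) && ((t, w) \notin N)).
  by case: ifP => // _; rewrite mxE.
apply/idP/andP => [/set_mem[/= tT Nz]|[tT Nz]].
  by split => //; rewrite notin_setE.
by apply/mem_set; split => //=; rewrite notin_setE in Nz.
Qed.

Lemma lebesgue_borel_restrict v : lebesgue_borel mpi T v ->
  exists N : set (X * W), [/\ measurable N, (lam \x mpi)%E N = 0%E &
    measurable_field (restrict_field N v)].
Proof.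
move=> mv.
have [N [mN N0 hN]] : exists N : set (X * W), [/\ measurable N, (lam \x mpi)%E N = 0%E &
    forall i : 'I_d, measurable_fun ([set z : Z | z.1.1 \in `[0, T]] `\` fst @^-1` N)
      (fun z => v z.1.1 z.1.2 z.2 0 i)].
  apply: (completed_measurable_fun_off mtime) => i.
  exact: (measurableT_comp (coord_measurable i) mv).
by exists N; split => //; exact: restrict_field_measurable.
Qed.

Lemma restrict_field_off (N : set (X * W)) v t w x : t \in `[0, T] -> ~ N (t, w) ->
  restrict_field N v t w x = v t w x.
Proof. by move=> tT Nt; rewrite /restrict_field tT/= memNset. Qed.

(* The value for times outside [0, T] is irrelevant; it makes the kernel a total
   measurable function. *)
Definition time_kernel (kappa : Omega -> R -> probability Y R) (p : X * W) :
  probability Y R := if p.1 \in `[0, T] then kappa p.2 p.1 else kappa point 0.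

Lemma time_kernel_measurable kappa : borel_collection T kappa ->
  forall U, measurable U -> measurable_fun setT (fun p => time_kernel kappa p U).
Proof.
move=> bk U mU.
pose A := [set p : X * W | p.1 \in `[0, T]].
have mA : measurable A.
  rewrite (_ : A = fst @^-1` `[0, T]%classic)//.
  by rewrite -[X in measurable X]setTI; exact: measurable_fst.
have mk := narrow_kernel_measurable (@normed_metrizes R E) mA bk mU.
rewrite -(setUv A); apply/measurable_funU => //; first exact: measurableC.
split.
  apply: eq_measurable_fun mk => p /set_mem Ap.
  by rewrite /time_kernel (_ : p.1 \in `[0, T]).
apply: (eq_measurable_fun (cst (kappa point 0 U))) => [p|]; last exact: measurable_cst.
rewrite in_setC /time_kernel; case: ifP => // pT; by rewrite mem_set.
Qed.

Lemma time_kernel_disintegration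
    (kappa : Omega -> R -> probability Y R)
    (m : R -> probability (borel (Omega * E)%type) R) :
  borel_collection T kappa ->
  (forall t, t \in `[0, T] -> disintegration mpi (m t) (kappa ^~ t)) ->
  forall t, `[0, T]%classic t -> forall f : W * Y -> \bar R,
    measurable_fun setT f -> (forall z, 0 <= f z)%E ->
    (\int[m t]_z f (borel_pair z) =
     \int[mpi]_w \int[time_kernel kappa (t, w)]_y f (w, y))%E.
Proof.
move=> bk dis t tT f mf f0.
have E0 w : time_kernel kappa (t, w) = kappa w t by rewrite /time_kernel/= tT.
apply: (@ge0_disintegration _ _ _ W Y (borel (Omega * E)%type) R mpi (@borel_pair Omega E)
  (@borel_pair_measurable Omega E) (m t) (fun w => time_kernel kappa (t, w))) => //.
- move=> U mU; apply: (measurableT_comp (time_kernel_measurable bk mU)).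
  exact: pair1_measurable.
- move=> g mg bg; under [RHS]eq_integral do rewrite E0.
  apply: (dis t tT) => //.
  exact: (measurableT_comp mg (@borel_pair_measurable Omega E)).
Qed.

Lemma transport_measurable v (phi : R -> Omega -> E -> R) :
  measurable_field v ->
  measurable_fun setT (fun z : Z => dtime (fun t => phi t z.1.2) z.1.1 z.2) ->
  (forall i, measurable_fun setT
    (fun z : Z => grad (fun t => phi t z.1.2) z.1.1 z.2 0 i)) ->
  measurable_fun setT (fun z : Z =>
    transport (fun s => phi s z.1.2) (fun s => v s z.1.2) z.1.1 z.2).
Proof.
move=> mv mt mg; apply: measurable_funD => //; rewrite /dotv.
by apply: measurable_sum => i; apply: measurable_funM.
Qed.

Lemma solves_E_of_fibers v (kappa : Omega -> R -> probability Y R)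
    (mu : R -> probability (borel (Omega * E)%type) R) :
  polish_space R Omega -> lebesgue_borel mpi T v ->
  borel_collection T kappa ->
  (forall w, solves_Eomega T (fun t => v t w) (kappa w)) ->
  (forall t : R, t \in `[0, T] -> disintegration mpi (mu t) (kappa ^~ t)) ->
  solves_E T v mu.
Proof.
move=> pO lbv bk sol dis phi A /=.
have sO := polish_second_countable pO.
have [N [mN N0 mv]] := lebesgue_borel_restrict lbv.
set v' := restrict_field N v in mv.
pose F0 (z : Z) := (transport (fun s => phi s z.1.2) (fun s => v s z.1.2) z.1.1 z.2)%:E.
pose F (z : Z) := (transport (fun s => phi s z.1.2) (fun s => v' s z.1.2) z.1.1 z.2)%:E.
have mF : measurable_fun setT F.
  apply/measurable_EFinP; apply: transport_measurable => //.
    exact: Adm_dtime_measurable A.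
  by move=> i; exact: Adm_grad_measurable A.
have F0F (z : X * W) (y : Y) : `[0, T]%classic z.1 -> ~ N z -> F0 (z, y) = F (z, y).
  case: z => t w /= tT Nz; rewrite /F0 /F /transport /v' /=.
  by rewrite restrict_field_off.
have mk := time_kernel_measurable bk.
have tdis := time_kernel_disintegration bk dis.
have mj := @borel_pair_measurable Omega E.
have mD : measurable `[0, T]%classic by exact: measurable_itv.
have aF (z : X * W) (y : Y) : `[0, T]%classic z.1 -> ~ N z ->
    (abse \o F0) (z, y) = (abse \o F) (z, y).
  by move=> zT Nz; congr abse; exact: F0F.
have aE := integral_time_off (lam := lam) (P := mpi) mj tdis mN N0 aF.
have FE := integral_time_off (lam := lam) (P := mpi) mj tdis mN N0 F0F.
(* The Borel field replaces [v] both in the convergence condition and in the equation. *)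
rewrite [X in (X < _)%E -> _]aE [X in _ -> X = _]FE => {aE FE} foo.
have mFa : measurable_fun setT (abse \o F) by exact: measurableT_comp.
rewrite (ge0_disintegration_fubini lam mD mk tdis mFa) in foo; last first.
  by move=> z; exact: abse_ge0.
rewrite (disintegration_fubini (lam := lam) mD mk tdis mF foo).
(* It remains to see that the time integral is 0 for almost every parameter; with [v] put back, this
   is (E_w) tested on phi(., w, .). *)
rewrite (@ae_eq_integral _ _ _ _ _ (cst 0%E)) ?integral_cst ?mul0e//.
  exact: measurable_int (integrable_time_kernel (lam := lam) mD mk mF foo).
apply: filterS (integral_time_off_ae (lam := lam) `[0, T]%classic (time_kernel kappa) mN N0).
move=> w h _; rewrite -(h F0 F F0F).
have [_ _ phiC _] := A.
apply: (etrans _ (sol w (fun t => phi t w) (phiC w))).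
by apply: eq_integral => t; rewrite inE => tT; rewrite /time_kernel/= tT.
Qed.

End CommonSetting.

(** * Fiber integrals dominated by one weight *)

Section DominatedFunctional.
Local Open Scope ereal_scope.
Context dx dw dy (X : measurableType dx) (W : measurableType dw)
  (Y : measurableType dy) (R : realType).
Variables (lam : {sigma_finite_measure set X -> \bar R}) (P : probability W R).
Variables (D : set X) (mD : measurable D).
Variable k : X * W -> probability Y R.
Hypothesis mk : forall U, measurable U -> measurable_fun setT (fun z => k z U).
Variable q : (X * W) * Y -> R.
Hypotheses (mq : measurable_fun setT q) (q0 : forall z, (0 <= q z)%R).

Definition fiber_integral (f : (X * W) * Y -> R) (w : W) : \bar R :=
  \int[lam]_(t in D) \int[k (t, w)]_y (f ((t, w), y))%:E.

Hypothesis q_fin : forall z, \int[k z]_y (q (z, y))%:E < +oo.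
Hypothesis q_fiber : forall w, fiber_integral q w < +oo.
Hypothesis q_int : \int[P]_w fiber_integral q w < +oo.

Implicit Types f g : (X * W) * Y -> R.

(** Since the integrals of [q] are finite for every [z] and every [w], each dominated function has
    finite fiber integrals everywhere, and [fiber_integral] is linear on such functions at every
    parameter. *)
Definition dominated (C : R) f : Prop :=
  [/\ measurable_fun setT f, (0 <= C)%R & forall z, (`|f z| <= C * q z)%R].

Let mE f : measurable_fun setT f -> measurable_fun setT (EFin \o f).
Proof. by move=> mf; exact/measurable_EFinP. Qed.

Let sec f z : measurable_fun setT f -> measurable_fun setT (fun y => (f (z, y))%:E).
Proof. by move=> mf; exact: (measurableT_comp (mE mf) (pair1_measurable z)). Qed.

Let kmeas f : measurable_fun setT f ->
  measurable_fun setT (fun z => \int[k z]_y (f (z, y))%:E).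
Proof. by move=> mf; exact: (kernel_integral_measurable mk (mE mf)). Qed.

Let tmeas f w : measurable_fun setT f ->
  measurable_fun D (fun t => \int[k (t, w)]_y (f ((t, w), y))%:E).
Proof.
move=> mf; apply: measurable_funTS.
exact: (measurableT_comp (kmeas mf) (pair2_measurable w)).
Qed.

Let kq_ge0 z : 0 <= \int[k z]_y (q (z, y))%:E.
Proof. by apply: integral_ge0 => y _; rewrite lee_fin. Qed.

Let abs_measurable f : measurable_fun setT f -> measurable_fun setT (fun z => `|f z|%R).
Proof. by move=> mf; exact: (measurableT_comp (@normr_measurable _ _) mf). Qed.

Let kabs_le C f z : dominated C f ->
  \int[k z]_y `|(f (z, y))%:E| <= C%:E * \int[k z]_y (q (z, y))%:E.
Proof.
move=> [mf C0 fq]; rewrite -ge0_integralZl//; last 2 first.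
- exact: sec.
- by move=> y _; rewrite lee_fin.
apply: ge0_le_integral => //.
- exact: (sec z (abs_measurable mf)).
- by apply: measurable_funeM; exact: sec.
- by move=> y _; rewrite -EFinM lee_fin.
Qed.

Lemma dominated_integrable_kernel C f z : dominated C f ->
  (k z).-integrable setT (fun y => (f (z, y))%:E).
Proof.
move=> df; have [mf C0 fq] := df; apply/integrableP; split; first exact: sec.
apply: (le_lt_trans (kabs_le z df)).
by rewrite lte_mul_pinfty// ge0_fin_numE.
Qed.

Let kle C f z : dominated C f ->
  `|\int[k z]_y (f (z, y))%:E| <= C%:E * \int[k z]_y (q (z, y))%:E.
Proof.
move=> df; have [mf _ _] := df; apply: le_trans (kabs_le z df).
by apply: le_abse_integral => //; exact: sec.
Qed.

Let tle C f w : dominated C f ->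
  \int[lam]_(t in D) `|\int[k (t, w)]_y (f ((t, w), y))%:E|
    <= C%:E * fiber_integral q w.
Proof.
move=> df; have [mf C0 _] := df; rewrite -ge0_integralZl//; last exact: tmeas.
apply: ge0_le_integral => //.
- by apply: measurableT_comp => //; exact: tmeas.
- by apply: measurable_funeM; exact: tmeas.
- by move=> t _; exact: kle.
Qed.

Lemma dominated_integrable_time C f w : dominated C f ->
  lam.-integrable D (fun t => \int[k (t, w)]_y (f ((t, w), y))%:E).
Proof.
move=> df; have [mf C0 _] := df; apply/integrableP; split; first exact: tmeas.
apply: (le_lt_trans (tle w df)).
by rewrite lte_mul_pinfty// ge0_fin_numE//; apply: integral_ge0.
Qed.

Lemma fiber_integral_le C f w : dominated C f ->
  `|fiber_integral f w| <= C%:E * fiber_integral q w.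
Proof.
move=> df; have [mf C0 _] := df; apply: le_trans (tle w df).
by apply: le_abse_integral => //; exact: tmeas.
Qed.

Lemma dominated_total_finite C f : dominated C f ->
  \int[P]_w \int[lam]_(t in D) \int[k (t, w)]_y `|(f ((t, w), y))%:E| < +oo.
Proof.
move=> df; have [mf C0 fq] := df.
have fq_ge0 w : 0 <= fiber_integral q w by apply: integral_ge0.
have dq : dominated 1 q by split => // z; rewrite mul1r ger0_norm.
have mS g : measurable_fun setT g -> (forall z, 0 <= g z)%R ->
    measurable_fun setT (fiber_integral g).
  move=> mg g0; apply: (ge0_measurable_time_kernel lam mD mk (mE mg)) => z.
  by rewrite lee_fin.
apply: (@le_lt_trans _ _ (\int[P]_w (C%:E * fiber_integral q w))); last first.
  rewrite ge0_integralZl//; last exact: mS.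
  by rewrite lte_mul_pinfty// ge0_fin_numE//; apply: integral_ge0.
apply: ge0_le_integral => //.
- by move=> w _; apply: integral_ge0 => t _; apply: integral_ge0.
- exact: (mS (fun z => `|f z|%R) (abs_measurable mf)).
- by apply: measurable_funeM; exact: mS.
- move=> w _; rewrite -ge0_integralZl//; last exact: tmeas.
  apply: ge0_le_integral => //.
  + by move=> t _; apply: integral_ge0.
  + exact: (tmeas w (abs_measurable mf)).
  + by apply: measurable_funeM; exact: tmeas.
  + by move=> t _; exact: kabs_le.
Qed.

Lemma fiber_integral_fin C f w : dominated C f -> fiber_integral f w \is a fin_num.
Proof.
move=> df; apply: integral_fune_fin_num => //.
exact: dominated_integrable_time df.
Qed.

Lemma fiber_integralZ C f (a : W -> R) w : dominated C f ->
  fiber_integral (fun z => a z.1.2 * f z)%R w = (a w)%:E * fiber_integral f w.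
Proof.
move=> df; rewrite /fiber_integral -integralZl//; last first.
  exact: dominated_integrable_time df.
apply: eq_integral => t _; rewrite -integralZl//; exact: dominated_integrable_kernel df.
Qed.

Lemma fiber_integralB C C' f g w : dominated C f -> dominated C' g ->
  fiber_integral (fun z => f z - g z)%R w = fiber_integral f w - fiber_integral g w.
Proof.
move=> df dg; rewrite /fiber_integral -integralB//; last 2 first.
- exact: dominated_integrable_time df.
- exact: dominated_integrable_time dg.
apply: eq_integral => t _; rewrite -integralB//.
- exact: dominated_integrable_kernel df.
- exact: dominated_integrable_kernel dg.
Qed.

End DominatedFunctional.

(** * Almost-everywhere vanishing from integrals against continuous functions *)

Section OpenSetsDetermine.
Context (R : realType) (X : ptopologicalType) (P : probability (borel X) R).
Variables (dist : X -> X -> R) (dm : metrizes dist).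
Local Open Scope ereal_scope.

(** The sets over which [G] integrates to 0 form a Dynkin class, closed under complement because the
    whole space is open; open sets are stable under intersection and generate the Borel sets. *)
Lemma integral_open_eq0 (G : borel X -> \bar R) : P.-integrable setT G ->
  (forall U : set X, open U -> \int[P]_(x in U) G x = 0) ->
  ae_eq P setT G (cst 0).
Proof.
move=> iG G0; have mG := measurable_int _ iG.
have iGA (A : set (borel X)) : measurable A -> P.-integrable A G.
  by move=> mA; apply: integrableS iG.
apply: integral_ae_eq => // A _ mA; rewrite integral0.
move: A mA; apply: (@dynkin_induction _ (borel X) (@open X)) => //.
- exact: openI.
- by apply: G0; exact: openT.
- move=> S mS S0; have := G0 setT openT.
  rewrite -(setUv S) integral_setU//.
  - by rewrite S0 add0e.
  - exact: measurableC.
  - by rewrite setUv.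
  - exact/disj_set2P/setICr.
- move=> F mF tF F0.
  rewrite integral_bigcup//; last by apply: iGA; exact: bigcupT_measurable.
  by rewrite eseries0.
Qed.

Lemma integral_continuous_eq0 (G : borel X -> \bar R) : P.-integrable setT G ->
  (forall x, G x \is a fin_num) ->
  (forall a : X -> R, continuous a -> (forall x, 0 <= a x <= 1)%R ->
    \int[P]_x ((a x)%:E * G x) = 0) ->
  ae_eq P setT G (cst 0).
Proof.
move=> iG Gfin Ga; have mG := measurable_int _ iG.
apply: integral_open_eq0 => // U oU.
have [f [cf f01 fU]] := open_indic_limit dm oU.
have mf n : measurable_fun setT (f n : borel X -> R) by exact: continuous_borel_measurable.
have mU : measurable (U : set (borel X)) by exact: sub_sigma_algebra.
rewrite integral_mkcond.
have E : (G \_ U) = (fun x => (\1_U x)%:E * G x).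
  apply/funext => x; rewrite patchE indicE; case: ifP => _; first by rewrite mul1e.
  by rewrite mul0e.
rewrite E.
have [|||||_ _ h] := @dominated_convergence _ (borel X) R P setT measurableT
  (fun n x => (f n x)%:E * G x) (fun x => (\1_U x)%:E * G x) (abse \o G).
- by move=> n; apply: emeasurable_funM => //; exact/measurable_EFinP.
- by apply: emeasurable_funM => //; exact/measurable_EFinP/measurable_indic.
(* Finiteness of [G x] reduces the claim to convergence of products of real numbers. *)
- apply: aeW => x _; rewrite -(fineK (Gfin x)).
  under eq_fun do rewrite -EFinM.
  rewrite -EFinM; apply/fine_cvgP; split; first exact: nearW.
  by apply: cvgM; [exact: fU|exact: cvg_cst].
- exact: integrable_abse.
- apply: aeW => x n _ /=; have /andP[f0 f1] := f01 n x.
  rewrite abseM -[leRHS]mul1e lee_wpmul2r//= lee_fin ger0_norm//.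
have := cvg_lim _ h; move=> <- //.
by under eq_fun do rewrite (Ga _ (cf _) (f01 _)); rewrite lim_cst.
Qed.

End OpenSetsDetermine.

Section TestFunctions.
Context (R : realType) (Omega : ptopologicalType) (T : R) (d : nat).
Local Notation E := 'rV[R]_d.

(** The leading 1 pays for the time derivative, the factor d comes from [dotv_le], and 1 + d n
    bounds 1 + |x| (Euclidean) on the sup-norm ball of radius n. *)
Definition transport_const (n : nat) : R := 1 + d%:R * (1 + d%:R * n%:R).

Lemma transport_const_ge0 n : 0 <= transport_const n.
Proof. by rewrite addr_ge0// mulr_ge0// addr_ge0// mulr_ge0. Qed.

(** Stated for an arbitrary pair [p], so that it applies both to a jet and to a difference of two
    jets. Inside the ball, write |b| as (1+|x|) times |b|/(1+|x|) and bound the first factor. *)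
Lemma transport_jet_le (p : R * E) (b x : E) (n : nat) (M : R) :
  (n%:R < `|x| -> p = 0) -> `|p| <= M ->
  `|p.1 + dotv p.2 b| <= M * transport_const n * (1 + enorm b / (1 + enorm x)).
Proof.
move=> px pM.
apply: (@le_trans _ _ (`|p| * transport_const n * (1 + enorm b / (1 + enorm x)))); last first.
  rewrite ler_wpM2r// ?ler_wpM2r ?transport_const_ge0//.
  by rewrite addr_ge0// divr_ge0 ?enorm_ge0// addr_ge0// enorm_ge0.
rewrite /transport_const; have [nx|xn] := ltP n%:R `|x|.
  by rewrite px//= dotv0l addr0 !normr0 !mul0r.
have p1 : `|p.1| <= `|p| by rewrite prod_normE le_max lexx.
have p2 : `|p.2| <= `|p| by rewrite prod_normE le_max lexx orbT.
have ex0 := enorm_ge0 x.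
have x1 : 0 < 1 + enorm x by rewrite ltr_wpDr.
have xn1 : 1 + enorm x <= 1 + d%:R * n%:R.
  by rewrite lerD2l (le_trans (enorm_le x))// ler_wpM2l.
set r := enorm b / (1 + enorm x).
have r0 : 0 <= r by rewrite divr_ge0 ?enorm_ge0// ltW.
have bE : enorm b = (1 + enorm x) * r by rewrite /r mulrC divfK// gt_eqF.
rewrite (le_trans (ler_normD _ _))//.
apply: (@le_trans _ _ (`|p| + d%:R * `|p| * ((1 + d%:R * n%:R) * r))).
  rewrite lerD// (le_trans (dotv_le _ _))// bE.
  apply: ler_pM; [by rewrite mulr_ge0|by rewrite mulr_ge0// ltW|
    by rewrite ler_wpM2l|by rewrite ler_wpM2r].
have c0 : 0 <= (d%:R * (1 + d%:R * n%:R) : R) by rewrite mulr_ge0// addr_ge0// mulr_ge0.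
have P0 : 0 <= `|p| by [].
have := mulr_ge0 P0 c0; have := mulr_ge0 P0 r0.
set c := d%:R * (1 + d%:R * n%:R) in c0 *.
have -> : d%:R * `|p| * ((1 + d%:R * n%:R) * r) = `|p| * c * r by rewrite /c; ring.
move=> h1 h2.
have -> : `|p| * (1 + c) * (1 + r) = `|p| + `|p| * c * r + (`|p| * r + `|p| * c) by ring.
by rewrite lerDl addr_ge0.
Qed.

Lemma transportZ (g : R -> E -> R) (b : R -> E -> E) (c t : R) (x : E) :
  is_C1 g -> transport (fun t x => c * g t x) b t x = c * transport g b t x.
Proof.
move=> [dt dx _ _]; rewrite /transport dtimeZ// gradZ; last exact: dx.
by rewrite dotvZl mulrDr.
Qed.

Lemma tensor_Adm (a : Omega -> R) (g : R -> E -> R) :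
  continuous a -> (forall w, 0 <= a w <= 1) -> C1c T g ->
  Adm T (fun t w x => a w * g t x).
Proof.
move=> ca a01 gC; have [M M0 hM] := C1c_bounded gC.
have [M' M'0 hM'] := C1c_jet_bounded gC.
have [[dt dx _ _] _ _] := gC.
have abs_le w (y B : R) : `|y| <= B -> `|a w * y| <= B.
  move=> yB; have /andP[a0 a1] := a01 w.
  by rewrite normrM ger0_norm// -[B]mul1r ler_pM.
split.
- have c1 : continuous (fun p : R * Omega * E => p.1.2).
    by move=> p; exact: (cvg_comp _ _ cvg_fst cvg_snd).
  have c2 : continuous (fun p : R * Omega * E => (p.1.1, p.2)).
    by move=> p; exact: (cvg_pair (cvg_comp _ _ cvg_fst cvg_fst) cvg_snd).
  apply: continuous_subspaceT => p; apply: cvgM.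
    exact: (cvg_comp _ _ (c1 p) (ca _)).
  exact: (cvg_comp _ _ (c2 p) (@C1c_continuous _ _ _ _ gC (p.1.1, p.2))).
- exists M; split; first exact: num_real.
  by move=> B MB p _ /=; rewrite (le_trans (abs_le _ _ _ (hM _ _)))// ltW.
- by move=> w; exact: C1cZ.
- apply: (@le_lt_trans _ _ (M + M' + d%:R * M')%:E); last exact: ltry.
  apply: ge_ereal_sup => _ [w _ <-]; apply: ge_ereal_sup => _ [[t x] _ <-] /=.
  have [h1 h2] := hM' t x.
  rewrite lee_fin lerD//; first rewrite lerD//.
  + exact: abs_le.
  + by rewrite dtimeZ//; exact: abs_le.
  + rewrite gradZ; last exact: dx.
    rewrite (le_trans (enorm_le _))// ler_wpM2l// normrZ.
    have /andP[a0 a1] := a01 w.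
    by rewrite ger0_norm// -[M']mul1r ler_pM.
Qed.

End TestFunctions.

Section Fibers.
Context (R : realType) (Omega : ptopologicalType)
  (mpi : probability (borel Omega) R) (T : R) (d : nat).
Local Notation E := 'rV[R]_d.
Local Notation W := (borel Omega).
Local Notation Y := (borel E).
Local Notation X := (measurableTypeR R).
Local Notation Z := (X * W * Y)%type.
Local Notation lam := (@lebesgue_measure R).
Local Notation D := `[0, T]%classic.
Implicit Types (v : R -> Omega -> E -> E).

Definition weight v (z : Z) : R := enorm (v z.1.1 z.1.2 z.2) / (1 + enorm z.2).

Lemma weight_ge0 v z : 0 <= weight v z.
Proof. by rewrite divr_ge0 ?enorm_ge0// addr_ge0// enorm_ge0. Qed.

Let sqrt_measurable : measurable_fun setT (@Num.sqrt R).
Proof. exact: (continuous_measurable_fun (@sqrt_continuous R)). Qed.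

Let enorm_measurable (f : Z -> E) :
  (forall i, measurable_fun setT (fun z => f z 0 i)) ->
  measurable_fun setT (fun z => enorm (f z)).
Proof.
move=> mf; apply: measurableT_comp; first exact: sqrt_measurable.
by apply: measurable_sum => i; exact: measurable_funM.
Qed.

Let inv_measurable : measurable_fun setT (fun z : Z => (1 + enorm z.2)^-1).
Proof.
have mi : measurable_fun setT (fun x : Y => (1 + enorm x)^-1).
  have mc : measurable_fun setT (fun x : Y => enorm x).
    have md : measurable_fun setT (fun x : Y => dotv x x).
      apply: measurable_sum => i.
      exact: (measurable_funM (coord_measurable i) (coord_measurable i)).
    exact: (measurableT_comp sqrt_measurable md).
  have m1 : measurable_fun setT (fun x : Y => 1 + enorm x).
    by apply: measurable_funD; [exact: measurable_cst|exact: mc].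
  rewrite (_ : (fun x => _) = (fun x : Y => (1 + enorm x) `^ (-1))).
    exact: (measurableT_comp (measurable_powR (-1)) m1).
  by apply/funext => x; rewrite powR_inv1// addr_ge0// enorm_ge0.
exact: (measurableT_comp mi measurable_snd).
Qed.

Lemma weight_measurable v : measurable_field v -> measurable_fun setT (weight v).
Proof. move=> mv; exact: (measurable_funM (enorm_measurable mv) inv_measurable). Qed.

Let one_weight v (z : Z) : R := 1 + weight v z.

Let DT : (lam D < +oo)%E.
Proof.
by rewrite lebesgue_measure_itv/=; case: ifP => _; rewrite -?EFinB ltry.
Qed.

(** The growth bound is moved from [v] to its Borel version, then by Tonelli from [mu] to the
    fibers; the constant 1 contributes only the length of the time interval. *)
Lemma weight_total_finite v (kappa : Omega -> R -> probability Y R)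
    (mu : R -> probability (borel (Omega * E)%type) R) (N : set (X * W)) :
  borel_collection T kappa ->
  (forall t : R, t \in `[0, T] -> disintegration mpi (mu t) (kappa ^~ t)) ->
  measurable N -> (lam \x mpi)%E N = 0%E ->
  measurable_field (restrict_field T N v) -> growth_bound T v mu ->
  (\int[mpi]_w \int[lam]_(t in D) \int[time_kernel T kappa (t, w)]_y
    (EFin \o one_weight (restrict_field T N v)) ((t, w), y) < +oo)%E.
Proof.
move=> bk dis mN N0 mv gb.
have mk := time_kernel_measurable bk.
have tdis := time_kernel_disintegration bk dis.
have mj := @borel_pair_measurable Omega E.
have mD : @measurable _ X D by exact: measurable_itv.
pose h0 (z : Z) := (weight v z)%:E.
pose h (z : Z) := (weight (restrict_field T N v) z)%:E.
have h0h (z : X * W) (y : Y) : D z.1 -> ~ N z -> h0 (z, y) = h (z, y).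
  by case: z => t w /= tT Nz; rewrite /h0 /h /weight/= restrict_field_off.
have mh : measurable_fun setT h by apply/measurable_EFinP; exact: weight_measurable.
have hge0 z : (0 <= h z)%E by rewrite lee_fin; exact: weight_ge0.
have hE := integral_time_off (lam := lam) (P := mpi) mj tdis mN N0 h0h.
have := gb; rewrite /growth_bound [X in (X < _)%E -> _]hE.
rewrite (ge0_disintegration_fubini lam mD mk tdis mh hge0) => hoo.
have -> : (\int[mpi]_w \int[lam]_(t in D) \int[time_kernel T kappa (t, w)]_y
    (EFin \o one_weight (restrict_field T N v)) ((t, w), y) =
    \int[mpi]_w \int[lam]_(t in D) \int[time_kernel T kappa (t, w)]_y
    (1 + h ((t, w), y)))%E by [].
rewrite (integral_add1 lam mpi mD mk mh hge0).
exact: lte_add_pinfty DT hoo.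
Qed.


Lemma fibers_of_solves_E v (mu : R -> probability (borel (Omega * E)%type) R)
    (kappa : Omega -> R -> probability Y R) :
  polish_space R Omega -> lebesgue_borel mpi T v ->
  solves_E T v mu -> borel_collection T kappa ->
  (forall t : R, t \in `[0, T] -> disintegration mpi (mu t) (kappa ^~ t)) ->
  growth_bound T v mu ->
  {ae mpi, forall w, solves_Eomega T (fun t => v t w) (kappa w)}.
Proof.
move=> pO lbv solE bk dis gb.
have [dist dm] := polish_metrizes pO.
have mk := time_kernel_measurable bk.
have tdis := time_kernel_disintegration bk dis.
have mj := @borel_pair_measurable Omega E.
have mD : @measurable _ X D by exact: measurable_itv.
have [N [mN N0 mv1]] := lebesgue_borel_restrict lbv.
have q1oo := weight_total_finite bk dis mN N0 mv1 gb.
set v1 := restrict_field T N v in mv1 q1oo.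
set q1 := one_weight v1 in q1oo.
have mq1 : measurable_fun setT q1.
  by apply: measurable_funD; [exact: measurable_cst|exact: weight_measurable].
have q10 z : (0 <= (EFin \o q1) z)%E by rewrite lee_fin addr_ge0 ?ler01 ?weight_ge0.
have mq1E : measurable_fun setT (EFin \o q1) by exact/measurable_EFinP.
have [B [mB B0 kB fB]] := finite_off_null (lam := lam) (P := mpi) mD mk mq1E q10 q1oo.
(* Off [B] all the integrals of [q1] that occur are finite.  Zeroing the field
   on [B] makes them finite everywhere, so that the functionals [S g] below are
   finite and linear in [g] without exceptional parameters. *)
pose v2 := restrict_field T B v1.
have mv2 : measurable_field v2.
  by apply: restrict_field_measurable => // i; exact: measurable_funTS.
pose q (z : Z) := 1 + weight v2 z.
have mq : measurable_fun setT q.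
  by apply: measurable_funD; [exact: measurable_cst|exact: weight_measurable].
have q0 z : 0 <= q z by rewrite addr_ge0// weight_ge0.
have qB t w y : B (t, w) -> q ((t, w), y) = 1.
  move=> Btw; rewrite /q /weight /v2 /restrict_field/= (mem_set Btw) andbF.
  by rewrite /enorm dotv0l sqrtr0 mul0r addr0.
have qD t w y : t \notin `[0, T] -> q ((t, w), y) = 1.
  move=> tT; rewrite /q /weight /v2 /restrict_field/= (negbTE tT)/=.
  by rewrite /enorm dotv0l sqrtr0 mul0r addr0.
have qnB t w y : t \in `[0, T] -> ~ B (t, w) -> q ((t, w), y) = q1 ((t, w), y).
  by move=> tT Btw; rewrite /q /weight /v2/= restrict_field_off.
have q_le t w y : q ((t, w), y) <= q1 ((t, w), y).
  have [Btw|Btw] := pselect (B (t, w)).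
    by rewrite qB// /q1 lerDl weight_ge0.
  have [tT|tT] := boolP (t \in `[0, T]); first by rewrite qnB.
  by rewrite qD// /q1 lerDl weight_ge0.
have mqE : measurable_fun setT (EFin \o q) by exact/measurable_EFinP.
have q0E (z : Z) : (0 <= (EFin \o q) z)%E by rewrite lee_fin; exact: q0.
have q_leE (z : Z) : ((EFin \o q) z <= (EFin \o q1) z)%E.
  by case: z => -[t w] y; rewrite lee_fin; exact: q_le.
have qnBE (z : X * W) (y : Y) : D z.1 -> ~ B z -> (EFin \o q) (z, y) = (EFin \o q1) (z, y).
  by case: z => t w tT Btw; congr EFin; exact: qnB.
have qBE (z : X * W) (y : Y) : ~ D z.1 \/ B z -> (EFin \o q) (z, y) = 1%E.
  case: z => t w [tT|Btw]; congr EFin; last exact: qB.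
  by apply: qD; apply/negP.
have [q_fin q_fiber' q_int'] := truncation_finite (lam := lam) (P := mpi) mD mk DT mq1E mqE
  q0E q_leE qnBE qBE q1oo kB fB.
have q_fiber w : (fiber_integral (X := X) lam D (time_kernel T kappa) q w < +oo)%E := q_fiber' w.
have q_int : (\int[mpi]_w fiber_integral (X := X) lam D (time_kernel T kappa) q w < +oo)%E := q_int'.
have qE t w y : q ((t, w), y) = 1 + enorm (v2 t w y) / (1 + enorm y) by [].
pose c := @transport_const R d.
have c0 n : 0 <= c n by exact: transport_const_ge0.
pose F (g : R -> E -> R) (z : Z) := transport g (fun s => v2 s z.1.2) z.1.1 z.2.
have mF g : C1c T g -> measurable_fun setT (F g).
  move=> [[_ _ ct cx] _ _].
  apply: (@transport_measurable _ _ _ _ (fun t _ => g t)) => //.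
    exact: (continuous_time_space_measurable ct).
  move=> i; apply: (@continuous_time_space_measurable _ _ _ (fun q => grad g q.1 q.2 0 i)) => p.
  exact: (cvg_comp _ _ (cx p) (@coord_continuous _ _ _ 0 i _)).
have domF g : C1c T g -> exists C, dominated q C (F g).
  move=> gC; have [M M0 hM] := C1c_jet_bounded gC.
  have [n hn] := C1c_supp_bounded gC.
  exists (M * c n); split; [exact: mF|by rewrite mulr_ge0|move=> [[t w] y]].
  have jM : `|jet g (t, y)| <= M by rewrite prod_normE/= ge_max; have [-> ->] := hM t y.
  by rewrite qE; exact: (transport_jet_le (v2 t w y) (hn t y) jM).
have domB g g' n (e : R) : C1c T g -> C1c T g' -> 0 <= e ->
    (forall t x, n%:R < `|x| -> jet g (t, x) = 0 /\ jet g' (t, x) = 0) ->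
    (forall p, `|jet g p - jet g' p| <= e) ->
    dominated q (e * c n) (fun z => F g z - F g' z).
  move=> gC g'C e0 gn ge; split.
  - by apply: measurable_funB; exact: mF.
  - by rewrite mulr_ge0.
  - move=> [[t w] y].
    have -> : F g (t, w, y) - F g' (t, w, y) = (jet g (t, y) - jet g' (t, y)).1 +
        dotv (jet g (t, y) - jet g' (t, y)).2 (v2 t w y).
      by rewrite /F /transport /jet/= dotvBl opprD addrACA.
    have j0 : n%:R < `|y| -> jet g (t, y) - jet g' (t, y) = 0.
      by move=> /(gn t)[-> ->]; rewrite subrr.
    by rewrite qE; exact: (transport_jet_le (v2 t w y) j0 (ge (t, y))).
(* [S g w] is the left-hand side of (E_w) for [g], with the truncated field [v2] in place of [v];
   the two fields agree off [Nv] for times in [[0, T]]. *)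
pose S g := fiber_integral (X := X) lam D (time_kernel T kappa) (F g).
pose Nv := N `|` B.
have mNv : measurable Nv by exact: measurableU.
have Nv0 : (lam \x mpi)%E Nv = 0%E by rewrite measureU0.
have v2E t w y : t \in `[0, T] -> ~ Nv (t, w) -> v2 t w y = v t w y.
  move=> tT /not_orP[Ntw Btw].
  by rewrite /v2 restrict_field_off// /v1 restrict_field_off.
have Sae g : C1c T g -> {ae mpi, forall w, S g w = 0%E}.
  move=> gC; have [C dF] := domF g gC.
  have toF := dominated_total_finite (lam := lam) (P := mpi) mD mk mq q0 q_int dF.
  have mFE : measurable_fun setT (EFin \o F g) by apply/measurable_EFinP; exact: (mF g gC).
  suff : ae_eq mpi setT (S g) (cst 0%E) by apply: filterS => w /(_ I).
  apply: (integral_continuous_eq0 dm).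
  - exact: (integrable_time_kernel (lam := lam) mD mk mFE toF).
  - by move=> w; exact: (fiber_integral_fin (lam := lam) mD mk mq q0 q_fiber w dF).
  - move=> a ca a01.
    pose aF (z : Z) := a z.1.2 * F g z.
    have ma : measurable_fun setT (fun z : Z => a z.1.2).
      apply: (measurableT_comp (continuous_borel_measurable ca)).
      exact: (measurableT_comp measurable_snd measurable_fst).
    have maF : measurable_fun setT aF by apply: measurable_funM => //; exact: mF.
    have daF : dominated q C aF.
      have [_ C0 FC] := dF; split => // z; have /andP[a0 a1] := a01 z.1.2.
      by rewrite /aF normrM ger0_norm// (le_trans _ (FC z))// ler_piMl.
    have toaF := dominated_total_finite (lam := lam) (P := mpi) mD mk mq q0 q_int daF.
    have maFE : measurable_fun setT (EFin \o aF) by exact/measurable_EFinP.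
    have AE := disintegration_fubini (lam := lam) mD mk tdis maFE toaF.
    transitivity (\int[mpi]_w \int[lam]_(t in D)
        \int[time_kernel T kappa (t, w)]_y (EFin \o aF) ((t, w), y))%E.
      apply: eq_integral => w _; apply/esym.
      exact: (fiber_integralZ (lam := lam) mD mk mq q0 q_fin q_fiber a w dF).
    rewrite -AE.
    pose f0 (z : Z) := (transport (fun t x => a z.1.2 * g t x)
      (fun s => v s z.1.2) z.1.1 z.2)%:E.
    have [g1 _ _] := gC.
    have f0E (z : X * W) (y : Y) : D z.1 -> ~ Nv z -> f0 (z, y) = (EFin \o aF) (z, y).
      case: z => t w tT Ntw; congr EFin; rewrite /aF /F -transportZ//=.
      by rewrite /transport v2E.
    have f0Ea (z : X * W) (y : Y) : D z.1 -> ~ Nv z ->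
        (abse \o f0) (z, y) = (abse \o (EFin \o aF)) (z, y).
      by move=> zT Nz; congr abse; exact: f0E.
    rewrite -(integral_time_off (lam := lam) (P := mpi) mj tdis mNv Nv0 f0E).
    apply: (solE _ (tensor_Adm ca a01 gC)).
    (* The convergence condition of [solves_E] for this test function: its integrand agrees off [Nv]
       with [aF], which is dominated by the weight. *)
    have := integral_time_off (lam := lam) (P := mpi) mj tdis mNv Nv0 f0Ea.
    move=> h; rewrite [X in (X < _)%E]h.
    rewrite (ge0_disintegration_fubini lam mD mk tdis)//.
      exact: measurableT_comp.
    by move=> z; exact: abse_ge0.
have [G [GC Gdense]] := @C1c_countable_dense R d T.
have Gae : {ae mpi, forall w, forall n, if unpickle n is Some i then S (G i) w = 0%E else True}.
  by apply/ae_foralln => n; case: unpickle => [i|]; [exact: Sae|exact: aeW].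
have offae := integral_time_off_ae (lam := lam) D (time_kernel T kappa) mNv Nv0.
(* Only here is [g] introduced: both exceptional sets, that of the countable family and that of
   [Nv], were fixed beforehand. *)
apply: filterS2 Gae offae => w hG hoff g gC.
pose f0 (z : Z) := (transport g (fun s => v s z.1.2) z.1.1 z.2)%:E.
have f0E (z : X * W) (y : Y) : D z.1 -> ~ Nv z -> f0 (z, y) = (EFin \o F g) (z, y).
  by case: z => t u tT Ntw; congr EFin; rewrite /F /transport/= v2E.
transitivity (\int[lam]_(t in D) \int[time_kernel T kappa (t, w)]_y f0 ((t, w), y))%E.
  by apply: eq_integral => t; rewrite inE => tT; rewrite /time_kernel/= tT.
rewrite (hoff _ _ f0E) -[LHS]/(S g w).
have [C dF] := domF g gC.
have Sfin : S g w \is a fin_num by exact: (fiber_integral_fin (lam := lam) mD mk mq q0 q_fiber w dF).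
have qfin : fiber_integral (X := X) lam D (time_kernel T kappa) q w \is a fin_num.
  rewrite ge0_fin_numE//; apply: integral_ge0 => t _.
  by apply: integral_ge0 => y _; rewrite lee_fin.
have [n hn] := Gdense g gC.
pose r := fine (fiber_integral (X := X) lam D (time_kernel T kappa) q w).
have r0 : 0 <= r.
  apply/fine_ge0/integral_ge0 => t _.
  by apply: integral_ge0 => y _; rewrite lee_fin.
(* Choose [G i] with jet within [e] of that of [g] and vanishing outside the same ball; as
   [S (G i) w] is 0, [S g w] equals the fiber integral of the difference. *)
have Sle e : 0 < e -> `|fine (S g w)| <= e * (c n * r).
  move=> e0; have [i [gi gie]] := hn e e0.
  have dd := domB g (G i) n e gC (GC i) (ltW e0) gi gie.
  have [C' dF'] := domF (G i) (GC i).
  have Si : S (G i) w = 0%E by have := hG (pickle i); rewrite pickleK.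
  have := fiber_integral_le lam mD mk mq q0 w dd.
  rewrite (fiber_integralB (lam := lam) mD mk mq q0 q_fin q_fiber w dF dF') -/(S g w) -/(S (G i) w) Si sube0.
  rewrite -(fineK qfin) -/r -(fineK Sfin) -EFinM lee_fin.
  by rewrite /= mulrA.
rewrite -(fineK Sfin); congr EFin; apply/eqP; rewrite -normr_le0.
apply/ler_addgt0Pl => e e0; rewrite addr0.
(* Adding 1 keeps the divisor positive even when [r] is 0. *)
have k0 : 0 < c n * r + 1 by rewrite ltr_wpDl// mulr_ge0.
have ek0 : 0 < e / (c n * r + 1) by rewrite divr_gt0.
rewrite (le_trans (Sle _ ek0))// mulrAC ler_pdivrMr// ler_wpM2l ?(ltW e0)//.
by rewrite lerDl.
Qed.

End Fibers.

Theorem theorem4p3 (R : realType) (Omega : ptopologicalType)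
    (mpi : probability (borel Omega) R) (T : R) (d : nat)
    (v : R -> Omega -> 'rV[R]_d -> 'rV[R]_d) :
  polish_space R Omega -> 0 < T -> lebesgue_borel mpi T v ->
  (forall (mu : R -> probability (borel (Omega * 'rV[R]_d)%type) R)
      (kappa : Omega -> R -> probability (borel 'rV[R]_d) R),
    (forall t : R, t \in `[0, T] -> first_marginal mpi (mu t)) ->
    borel_curve T mu ->
    solves_E T v mu ->
    borel_collection T kappa ->
    (forall t : R, t \in `[0, T] -> disintegration mpi (mu t) (kappa ^~ t)) ->
    growth_bound T v mu ->
    {ae mpi, forall w, solves_Eomega T (fun t => v t w) (kappa w)})
  /\
  (forall (kappa : Omega -> R -> probability (borel 'rV[R]_d) R)
      (mu : R -> probability (borel (Omega * 'rV[R]_d)%type) R),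
    borel_collection T kappa ->
    (forall w, continuous_curve T (kappa w)) ->
    (forall w, solves_Eomega T (fun t => v t w) (kappa w)) ->
    (forall t : R, t \in `[0, T] -> first_marginal mpi (mu t)) ->
    (forall t : R, t \in `[0, T] -> disintegration mpi (mu t) (kappa ^~ t)) ->
    growth_bound T v mu ->
    solves_E T v mu).
Proof.
move=> pO T0 lbv; split.
  move=> mu kappa _ _ solE bk dis gb.
  exact: (fibers_of_solves_E pO lbv solE bk dis gb).
move=> kappa mu bk _ sol _ dis _.
exact: (solves_E_of_fibers pO lbv bk sol dis).
Qed.
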